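(* Let $0<\alpha<1$ and $p,q>0$. For positive semidefinite $n\times n$ complex matrices $A,B$ (any $n\in\mathbb{N}$) put $\mathcal{A}_{\alpha,p}(A,B):=((1-\alpha)A^p+\alpha B^p)^{1/p}$. Then the following conditions are equivalent: (i) $\mathcal{A}_{\alpha,p}(A,B)\le\mathcal{A}_{\alpha,q}(A,B)$ for all positive semidefinite $A,B\in\mathbb{M}_n$ and all $n\in\mathbb{N}$; (ii) $\mathcal{A}_{\alpha,p}(A,B)\le\mathcal{A}_{\alpha,q}(A,B)$ for all positive definite $2\times2$ matrices $A,B$; (iii) $p=q$, or $1\le p<q$, or $1/2\le p<1\le q$.
   Context: $\mathbb{M}_n$ denotes the $n\times n$ complex matrices. $X\le Y$ denotes the Loewner order ($Y-X$ positive semidefinite). *)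

(* Defs.v *)
From HB Require Import structures.
From mathcomp Require Import all_boot all_order all_algebra.
From mathcomp Require Import sesquilinear spectral.
From mathcomp Require Import complex.
From mathcomp Require Import reals exp.

Set Implicit Arguments.
Unset Strict Implicit.
Unset Printing Implicit Defensive.

Import Order.TTheory GRing.Theory Num.Theory Num.Def.
Local Open Scope ring_scope.
Local Open Scope complex_scope.

Definition hermitian (R : realType) (n : nat) (A : 'M[R[i]]_n) : Prop :=
  map_mx conjC (A^T) = A.

Definition psdmx (R : realType) (n : nat) (A : 'M[R[i]]_n) : Prop :=
  hermitian A /\
  forall v : 'rV[R[i]]_n, 0 <= (v *m A *m map_mx conjC (v^T)) 0 0.

Definition pdmx (R : realType) (n : nat) (A : 'M[R[i]]_n) : Prop :=
  hermitian A /\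
  forall v : 'rV[R[i]]_n, v != 0 -> 0 < (v *m A *m map_mx conjC (v^T)) 0 0.

Definition loewner_le (R : realType) (n : nat) (X Y : 'M[R[i]]_n) : Prop :=
  psdmx (Y - X).

(* Real power A^p of a (positive semidefinite) matrix via the spectral
   decomposition A = P^-1 diag(d) P (P unitary) of spectral.v:
   A^p := P^-1 diag(d_j^p) P, where d_j^p = powR (Re d_j) p. *)
Definition mxpowR (R : realType) (n : nat) (A : 'M[R[i]]_n) (p : R) : 'M[R[i]]_n :=
  invmx (spectralmx A) *m
  diag_mx (\row_j ((powR (complex.Re (spectral_diag A 0 j)) p)%:C))
  *m spectralmx A.

Definition powmean (R : realType) (n : nat) (alpha p : R) (A B : 'M[R[i]]_n)
  : 'M[R[i]]_n :=
  mxpowR ((1 - alpha)%:C *: mxpowR A p + alpha%:C *: mxpowR B p) p^-1.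

(* Main.v *)
(** Sufficiency rests on one operator inequality: if (1-a)A + aB <= M then
    (1-a)A^r + aB^r <= M^r for 0 <= r <= 1.  The set of admissible exponents
    contains 0 and 1 and is closed under midpoints: summing the positive blocks
    [[A^r, A^m], [A^m, A^s]], m = (r+s)/2, gives [[M^r, X], [X, M^s]] >= 0, hence
    X <= M^m.  So it contains the dyadics, and by continuity all of [0,1].  The
    same blocks with exponents s and 2-s yield operator convexity of t^s for
    1 <= s <= 2.

    Necessity uses nearly singular 2x2 pairs and quadratic forms.  If p < 1/2, a
    perturbation of size d makes the e2-entry of the p-mean of order d^2, but that
    of the q-mean o(d^2).  If 1/2 <= p < q < 1, the small eigenvalues of the two
    sums are both of order T, but their top eigenvectors are tilted differently;
    on the small eigenvector of the q-sum the p-mean is of order T and the q-mean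
    of order T^(1/q). *)

From Pilot Require Import Defs.
From HB Require Import structures.
From mathcomp Require Import all_boot all_order all_algebra.
From mathcomp Require Import sesquilinear spectral.
From mathcomp Require Import complex.
From mathcomp Require Import reals exp.
From mathcomp Require Import boolp topology normedtype sequences.
From mathcomp Require Import ring lra.
Import Pilot.Defs.
Set Implicit Arguments.
Unset Strict Implicit.
Unset Printing Implicit Defensive.
Import Order.TTheory GRing.Theory Num.Theory Num.Def.
Import numFieldNormedType.Exports.
Local Open Scope ring_scope.
Local Open Scope complex_scope.
Local Open Scope sesquilinear_scope.

(** * Quadratic forms and unitary diagonalization *)

HB.lock Definition bform (R : realType) (n : nat) (A : 'M[R[i]]_n)
    (x y : 'rV[R[i]]_n) : R :=
  complex.Re ((x *m A *m y ^t*) 0 0).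

(** Meant for unitary [U]: a Hermitian matrix given by any orthonormal eigenbasis (the rows of [U])
    and real eigenvalues, not only by the basis that [spectralmx] selects. *)
HB.lock Definition smx (R : realType) (n : nat) (U : 'M[R[i]]_n)
    (d : 'rV[R]_n) : 'M[R[i]]_n :=
  U ^t* *m diag_mx (map_mx (real_complex R) d) *m U.

(* Locked, as unification otherwise unfolds [mxpowR] down to the spectral
   theorem. *)
HB.lock Definition mpow (R : realType) (n : nat) (A : 'M[R[i]]_n) (p : R) :
  'M[R[i]]_n := mxpowR A p.

Section Forms.
Variables (R : realType) (n : nat).
Implicit Types (A B M U : 'M[R[i]]_n) (x y z v : 'rV[R[i]]_n) (d e : 'rV[R]_n).

Lemma ReD (x y : R[i]) : complex.Re (x + y) = complex.Re x + complex.Re y.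
Proof. by case: x; case: y. Qed.

Lemma ReZ (c : R) (x : R[i]) : complex.Re (c%:C * x) = c * complex.Re x.
Proof. by case: x => a b /=; rewrite mul0r subr0. Qed.

Lemma conjC_real (c : R) : conjC c%:C = c%:C.
Proof. exact: conjc_real. Qed.

Lemma ctrD m k (A B : 'M[R[i]]_(m, k)) : (A + B) ^t* = A ^t* + B ^t*.
Proof. by rewrite linearD map_mxD. Qed.

Lemma ctrM m k l (A : 'M[R[i]]_(m, k)) (B : 'M_(k, l)) :
  (A *m B) ^t* = B ^t* *m A ^t*.
Proof. by rewrite trmx_mul map_mxM. Qed.

Lemma ctrZ m k (c : R) (A : 'M[R[i]]_(m, k)) : (c%:C *: A) ^t* = c%:C *: A ^t*.
Proof. by rewrite linearZ map_mxZ; congr (_ *: _); exact: conjC_real. Qed.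

Lemma bformDm A B x y : bform (A + B) x y = bform A x y + bform B x y.
Proof. by rewrite bform.unlock mulmxDr mulmxDl mxE ReD. Qed.

Lemma bformZm (c : R) A x y : bform (c%:C *: A) x y = c * bform A x y.
Proof. by rewrite bform.unlock -scalemxAr -scalemxAl mxE ReZ. Qed.

Lemma bformBm A B x y : bform (A - B) x y = bform A x y - bform B x y.
Proof.
by apply: (addIr (bform B x y)); rewrite -bformDm !subrK.
Qed.

Lemma bformZl (c : R) A x y : bform A (c%:C *: x) y = c * bform A x y.
Proof. by rewrite bform.unlock -!scalemxAl mxE ReZ. Qed.

Lemma bformZr (c : R) A x y : bform A x (c%:C *: y) = c * bform A x y.
Proof. by rewrite bform.unlock ctrZ -!scalemxAr mxE ReZ. Qed.

Lemma bform_mulmx A B x y : bform (A *m B) x y = bform B (x *m A) y.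
Proof. by rewrite bform.unlock mulmxA. Qed.

Lemma bform_mulmxr A B x y : hermitian B -> bform (A *m B) x y = bform A x (y *m B).
Proof. by move=> hB; rewrite bform.unlock ctrM hB !mulmxA. Qed.

Lemma qform_real A x : hermitian A ->
  (x *m A *m x ^t*) 0 0 = (bform A x x)%:C.
Proof.
move=> hA; rewrite bform.unlock.
have : conjC ((x *m A *m x ^t*) 0 0) = (x *m A *m x ^t*) 0 0.
  have -> : conjC ((x *m A *m x ^t*) 0 0) = ((x *m A *m x ^t*) ^t*) 0 0.
    by rewrite !mxE.
  by rewrite !ctrM trmxCK hA mulmxA.
case: (_ 0 0) => a b /= [] bb; apply/eqP; rewrite eq_complex /= eqxx /=.
by apply/eqP; lra.
Qed.

Lemma psdmxE A : psdmx A <-> hermitian A /\ forall v, 0 <= bform A v v.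
Proof.
by split=> -[hA A0]; split=> // v; move: (A0 v); rewrite qform_real// ler0c.
Qed.

Lemma pdmxE A :
  pdmx A <-> hermitian A /\ forall v, v != 0 -> 0 < bform A v v.
Proof.
by split=> -[hA A0]; split=> // v v0; move: (A0 v v0);
  rewrite qform_real// -(ltcR 0).
Qed.

Lemma hermitianD A B : hermitian A -> hermitian B -> hermitian (A + B).
Proof. by rewrite /hermitian => hA hB; rewrite ctrD hA hB. Qed.

Lemma hermitianZ (c : R) A : hermitian A -> hermitian (c%:C *: A).
Proof. by rewrite /hermitian => hA; rewrite ctrZ hA. Qed.

Lemma hermitianB A B : hermitian A -> hermitian B -> hermitian (A - B).
Proof.
by rewrite /hermitian => hA hB; rewrite linearB map_mxB; congr (_ - _).
Qed.

Lemma hermitian1 : hermitian (1%:M : 'M[R[i]]_n).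
Proof. by rewrite /hermitian trmx1 map_mx1. Qed.

(** In the eigenbasis of [smx U d] the form is the sum of the eigenvalues against these weights,
    which are nonnegative for [x = y]; scalar inequalities between eigenvalues thus pass to
    quadratic forms. *)
Definition wgt x y (j : 'I_n) : R := complex.Re (x 0 j * conjC (y 0 j)).

Lemma wgt_ge0 x j : 0 <= wgt x x j.
Proof.
rewrite /wgt; case: (x 0 j) => a b /=.
by rewrite mulrN opprK -!expr2 addr_ge0// sqr_ge0.
Qed.

(** The real and the imaginary parts each contribute a value of the binary quadratic form with
    matrix [[a, c], [c, b]], which is positive semidefinite. *)
Lemma wgt_amgm x y j (a b c : R) : 0 <= a -> 0 <= b -> c ^+ 2 <= a * b ->
  0 <= a * wgt x x j + 2 * (c * wgt x y j) + b * wgt y y j.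
Proof.
rewrite /wgt; case: (x 0 j) => s t; case: (y 0 j) => u v /= a0 b0 cab.
suff q (f g : R) : 0 <= a * f ^+ 2 + 2 * (c * (f * g)) + b * g ^+ 2.
  have -> : a * (s * s - t * - t) + 2 * (c * (s * u - t * - v)) +
            b * (u * u - v * - v) =
    (a * s ^+ 2 + 2 * (c * (s * u)) + b * u ^+ 2) +
    (a * t ^+ 2 + 2 * (c * (t * v)) + b * v ^+ 2) by ring.
  by rewrite addr_ge0.
have [a00|an0] := eqVneq a 0.
  have -> : c = 0.
    apply/eqP; rewrite -sqrf_eq0 eq_le sqr_ge0 andbT.
    by move: cab; rewrite a00 mul0r.
  by rewrite a00 !mul0r mulr0 !add0r mulr_ge0// sqr_ge0.
have a_gt0 : 0 < a by rewrite lt_def an0.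
rewrite -(pmulr_rge0 _ a_gt0).
have -> : a * (a * f ^+ 2 + 2 * (c * (f * g)) + b * g ^+ 2) =
  (a * f + c * g) ^+ 2 + (a * b - c ^+ 2) * g ^+ 2 by ring.
by rewrite addr_ge0 ?sqr_ge0// mulr_ge0 ?sqr_ge0// subr_ge0.
Qed.

Lemma bform_smx U d x y :
  bform (smx U d) x y =
  \sum_j d 0 j * wgt (x *m U ^t*) (y *m U ^t*) j.
Proof.
rewrite bform.unlock smx.unlock !mulmxA -(mulmxA _ U (y ^t*)).
have -> : U *m y ^t* = (y *m U ^t*) ^t* by rewrite ctrM trmxCK.
move: (x *m _) (y *m _) => a b.
rewrite mxE (big_morph _ ReD (erefl : complex.Re 0 = 0)).
apply: eq_bigr => j _; rewrite mul_mx_diag /wgt -ReZ; congr complex.Re.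
by rewrite !mxE -!mulrA mulrCA.
Qed.

Lemma hermitian_smx U d : hermitian (smx U d).
Proof.
rewrite /hermitian smx.unlock !ctrM trmxCK mulmxA; congr (_ *m _ *m _).
rewrite tr_diag_mx map_diag_mx -map_mx_comp; congr diag_mx.
by apply/matrixP => i j; rewrite !mxE; exact: conjC_real.
Qed.

Lemma smxM U d e : U \is unitarymx ->
  smx U d *m smx U e = smx U (\row_j (d 0 j * e 0 j)).
Proof.
move=> /unitarymxP UU; rewrite smx.unlock.
have gen (V D E W : 'M[R[i]]_n) : W *m V = 1%:M ->
    V *m D *m W *m (V *m E *m W) = V *m (D *m E) *m W.
  by move=> WV; rewrite -!mulmxA (mulmxA W) WV mul1mx.
have <- : diag_mx (map_mx (real_complex R) d) *m
    diag_mx (map_mx (real_complex R) e) =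
    diag_mx (map_mx (real_complex R) (\row_j (d 0 j * e 0 j))).
  rewrite mulmx_diag; congr diag_mx.
  by apply/matrixP => i j; rewrite !mxE rmorphM.
exact: gen.
Qed.

Lemma smxD U d e : smx U d + smx U e = smx U (d + e).
Proof.
by rewrite smx.unlock map_mxD raddfD mulmxDr mulmxDl.
Qed.

Lemma smxZ U (c : R) d : c%:C *: smx U d = smx U (c *: d).
Proof.
rewrite smx.unlock map_mxZ.
have -> (w : 'rV[R[i]]_n) : diag_mx (c%:C *: w) = c%:C *: diag_mx w.
  exact: linearZ.
by rewrite -scalemxAr -scalemxAl.
Qed.

Lemma smx_const U (c : R) : U \is unitarymx -> smx U (const_mx c) = c%:C%:M.
Proof.
move=> Uu; rewrite smx.unlock map_const_mx diag_const_mx mul_mx_scalar.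
rewrite -scalemxAl -(invmx_unitary Uu) mulVmx ?scalemx1//.
exact: unitarymx_unit.
Qed.

Lemma smx_le U d e v : (forall j, d 0 j <= e 0 j) ->
  bform (smx U d) v v <= bform (smx U e) v v.
Proof.
move=> de; rewrite !bform_smx; apply: ler_sum => j _.
by rewrite ler_wpM2r ?wgt_ge0.
Qed.

Lemma psdmx_smx U d : (forall j, 0 <= d 0 j) -> psdmx (smx U d).
Proof.
move=> d0; rewrite psdmxE; split=> [|v]; first exact: hermitian_smx.
by rewrite bform_smx sumr_ge0// => j _; rewrite mulr_ge0 ?wgt_ge0.
Qed.

Lemma hermitian_smxP A : hermitian A ->
  exists2 U, U \is unitarymx & exists d, A = smx U d.
Proof.
move=> hA; exists (spectralmx A); first exact: spectral_unitarymx.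
have hs : A \is hermsymmx by apply/is_hermitianmxP; rewrite expr0 scale1r hA.
exists (map_mx (@complex.Re R) (spectral_diag A)).
rewrite smx.unlock {1}(orthomx_spectralP (hermitian_normalmx hs)).
rewrite (invmx_unitary (spectral_unitarymx A)).
suff <- : spectral_diag A =
  map_mx (real_complex R) (map_mx (@complex.Re R) (spectral_diag A)) by [].
apply/matrixP => i j; rewrite !mxE (ord1 i); apply/esym/RRe_real.
exact: mxOverP (hermitian_spectral_diag_real hs) 0 j.
Qed.

Lemma smx_row U d j : U \is unitarymx ->
  let v := row j U in v *m smx U d = (d 0 j)%:C *: v.
Proof.
move=> Uu /=; rewrite smx.unlock !mulmxA -row_mul (unitarymxP Uu).
rewrite -!row_mul mul1mx; apply/rowP => k; rewrite !mxE (bigD1 j)//=.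
rewrite !mxE eqxx mulr1n big1 ?addr0// => l lj.
by rewrite !mxE eq_sym (negPf lj) mulr0n mul0r.
Qed.

Lemma bform_row1 U j : U \is unitarymx -> bform 1%:M (row j U) (row j U) = 1.
Proof.
move=> Uu; rewrite bform.unlock mulmx1.
by have /row_unitarymxP/(_ j j) := Uu; rewrite eqxx dotmxE => ->.
Qed.

Lemma bform_smx_row U d j : U \is unitarymx ->
  bform (smx U d) (row j U) (row j U) = d 0 j.
Proof.
move=> Uu; rewrite -[smx U d]mulmx1 bform_mulmx smx_row// bformZl.
by rewrite bform_row1// mulr1.
Qed.

Lemma row_unitarymx_neq0 U j : U \is unitarymx -> row j U != 0.
Proof.
move=> Uu; apply/eqP => r0; have := bform_row1 j Uu.
by rewrite r0 bform.unlock !mul0mx mxE /= => /eqP; rewrite eq_sym oner_eq0.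
Qed.

Lemma psdmxP A : psdmx A ->
  exists2 U : 'M[R[i]]_n, U \is unitarymx &
  exists2 d : 'rV[R]_n, (forall j, 0 <= d 0 j) & A = smx U d.
Proof.
rewrite psdmxE => -[/hermitian_smxP[U Uu [d ->]] A0]; exists U => //.
by exists d => // j; rewrite -(bform_smx_row d j Uu).
Qed.

Lemma mulCunitarymx U : U \is unitarymx -> U ^t* *m U = 1%:M.
Proof.
by move=> Uu; rewrite -(invmx_unitary Uu) mulVmx// unitarymx_unit.
Qed.

(* [P *m V] intertwines the two diagonal matrices, hence any function of them. *)
Lemma diag_calculus (P Q U V : 'M[R[i]]_n) d e (f : R -> R) :
    P *m Q = 1%:M -> Q *m P = 1%:M -> U *m V = 1%:M -> V *m U = 1%:M ->
  Q *m diag_mx (map_mx (real_complex R) e) *m P =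
    V *m diag_mx (map_mx (real_complex R) d) *m U ->
  Q *m diag_mx (\row_j (f (e 0 j))%:C) *m P =
    V *m diag_mx (\row_j (f (d 0 j))%:C) *m U.
Proof.
move=> PQ QP UV VU /(congr1 (fun M => P *m M *m V)).
rewrite !mulmxA PQ mul1mx -[_ *m U *m V]mulmxA UV mulmx1 -mulmxA => WE.
have : diag_mx (\row_j (f (e 0 j))%:C) *m (P *m V) =
    P *m V *m diag_mx (\row_j (f (d 0 j))%:C).
  apply/matrixP => i j; move/matrixP/(_ i j): WE; move: (P *m V) => W.
  rewrite !mul_diag_mx !mul_mx_diag !mxE.
  have [->|Wn0] := eqVneq (W i j) 0; first by rewrite !mulr0 !mul0r.
  move=> /eqP; rewrite mulrC (inj_eq (mulfI Wn0)) => /eqP/complexI ->.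
  by rewrite mulrC.
move=> /(congr1 (fun M => Q *m M *m U)).
by rewrite !mulmxA QP mul1mx -[_ *m V *m U]mulmxA VU mulmx1.
Qed.

(** The power does not depend on the diagonalization: [diag_calculus] compares the one chosen by
    [spectralmx] with the one given by [U]. *)
Lemma mpow_smx U d (p : R) : U \is unitarymx ->
  mpow (smx U d) p = smx U (\row_j powR (d 0 j) p).
Proof.
move=> Uu; have hs : smx U d \is hermsymmx.
  by apply/is_hermitianmxP; rewrite expr0 scale1r hermitian_smx.
have Pu := spectral_unitarymx (smx U d).
have fE : map_mx (real_complex R)
    (\row_j complex.Re (spectral_diag (smx U d) 0 j)) = spectral_diag (smx U d).
  apply/rowP => j; rewrite !mxE; apply: RRe_real.
  exact: mxOverP (hermitian_spectral_diag_real hs) 0 j.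
have := orthomx_spectralP (hermitian_normalmx hs).
rewrite -fE {1}smx.unlock (invmx_unitary Pu) => /esym.
move/(diag_calculus (fun t => powR t p) (unitarymxP Pu) (mulCunitarymx Pu)
  (unitarymxP Uu) (mulCunitarymx Uu)).
rewrite mpow.unlock /mxpowR (invmx_unitary Pu) => E.
have -> : \row_j (powR (complex.Re (spectral_diag (smx U d) 0 j)) p)%:C =
  \row_j (powR ((\row_j complex.Re (spectral_diag (smx U d) 0 j)) 0 j) p)%:C.
  by apply/rowP => j; rewrite !mxE.
rewrite E smx.unlock; apply: (congr1 (fun D => U ^t* *m diag_mx D *m U)).
by apply/rowP => j; rewrite !mxE.
Qed.

(** If the form vanishes at [v], positivity of the eigenvalues makes all coordinates of [v] in the
    eigenbasis zero. *)
Lemma pdmx_smx U d : U \is unitarymx -> (forall j, 0 < d 0 j) -> pdmx (smx U d).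
Proof.
move=> Uu d0; rewrite pdmxE; split=> [|v v0]; first exact: hermitian_smx.
have : psdmx (smx U d) by apply: psdmx_smx => j; exact: ltW.
rewrite psdmxE => -[_ /(_ v) ge0]; rewrite lt_def ge0 andbT.
apply/eqP; rewrite bform_smx => /eqP.
rewrite psumr_eq0 => [/allP z|j _]; last by rewrite mulr_ge0 ?wgt_ge0// ltW.
have vU : v *m U ^t* = 0.
  apply/rowP => j; rewrite [RHS]mxE.
  have := z j; rewrite mem_index_enum mulf_eq0 (gt_eqF (d0 j))/=.
  move=> /(_ isT); rewrite /wgt; case: (_ 0 j) => b c /=.
  rewrite mulrN opprK -!expr2 paddr_eq0 ?sqr_ge0// !sqrf_eq0.
  by move=> /andP[/eqP-> /eqP->].
have := congr1 (mulmx^~ U) vU.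
by rewrite /= -mulmxA mulCunitarymx// mulmx1 mul0mx => /eqP; rewrite (negPf v0).
Qed.

Lemma pdmx_psdmx A : pdmx A -> psdmx A.
Proof.
rewrite pdmxE psdmxE => -[hA A0]; split=> // v; have [->|v0] := eqVneq v 0.
  by rewrite bform.unlock !mul0mx mxE.
exact/ltW/A0.
Qed.

End Forms.

(** * Real powers of matrices and the geometric-mean bound *)

Section Powers.
Variable (R : realType).
Implicit Types (a r s t : R).

(** Nonnegative exponents keep the law valid at [x = 0], where [powR 0 0 = 1]. *)
Lemma powRD_ge0 (x s t : R) : 0 <= s -> 0 <= t -> powR x (s + t) = powR x s * powR x t.
Proof.
move=> s0 t0; have [->|sn0] := eqVneq s 0; first by rewrite add0r powRr0 mul1r.
by rewrite powRD// gt_eqF//= ltr_wpDr// lt_def sn0.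
Qed.

Lemma powRD_gt0 (x s t : R) : 0 < x -> powR x (s + t) = powR x s * powR x t.
Proof. by move=> x0; rewrite powRD// (gt_eqF x0) implybT. Qed.

(** The ratios u = x/(x+y) and u = y/(x+y) lie in [0, 1], so u <= u^r, and they add up to 1. *)
Lemma powR_add_le (x y r : R) : 0 <= x -> 0 < y -> 0 <= r <= 1 ->
  powR (x + y) r <= powR x r + powR y r.
Proof.
move=> x0 y0 /andP[r0 r1].
have xy : 0 < x + y by rewrite ltr_wpDl.
have aux z : 0 <= z -> z <= x + y -> powR (x + y) r * (z / (x + y)) <= powR z r.
  move=> z0 zxy; have [->|zn0] := eqVneq z 0; first by rewrite mul0r mulr0 powR_ge0.
  have zE : powR z r = powR (x + y) r * powR (z / (x + y)) r.
    rewrite -powRM ?divr_ge0 ?(ltW xy)//; congr powR.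
    by rewrite mulrCA divff ?mulr1// gt_eqF.
  rewrite [leRHS]zE ler_wpM2l ?powR_ge0// ger1_powR//.
  by rewrite divr_gt0 ?(lt_def 0 z) ?zn0//= ler_pdivrMr// mul1r.
apply: le_trans (lerD (aux x x0 _) (aux y (ltW y0) _)); last 2 first.
- by rewrite lerDl ltW.
- by rewrite lerDr.
by rewrite -mulrDr -mulrDl divff ?mulr1// gt_eqF.
Qed.

Lemma powR_mid_sq (x r s : R) : 0 <= r -> 0 <= s ->
  powR x ((r + s) / 2) ^+ 2 = powR x r * powR x s.
Proof.
move=> r0 s0; rewrite -powRD_ge0// expr2 -powRD_ge0 ?divr_ge0 ?addr_ge0//.
by congr powR; lra.
Qed.

Variable n : nat.
Implicit Types (A B M X U : 'M[R[i]]_n) (x y z v w : 'rV[R[i]]_n) (d e : 'rV[R]_n).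

Lemma bform_conj A B X x y : hermitian X ->
  bform A (x *m B) (y *m X) = bform (B *m A *m X) x y.
Proof. by move=> hX; rewrite -bform_mulmxr// -bform_mulmx !mulmxA. Qed.

Lemma hermitian_mpow A r : hermitian A -> hermitian (mpow A r).
Proof.
by move=> /hermitian_smxP[U Uu [d ->]]; rewrite mpow_smx//; exact: hermitian_smx.
Qed.

Lemma psdmx_mpow A r : psdmx A -> psdmx (mpow A r).
Proof.
move=> /psdmxP[U Uu [d d0 ->]]; rewrite mpow_smx//; apply: psdmx_smx => j.
by rewrite mxE powR_ge0.
Qed.

Lemma mpow_mpow A r s : psdmx A -> mpow (mpow A r) s = mpow A (r * s).
Proof.
move=> /psdmxP[U Uu [d d0 ->]]; rewrite !mpow_smx//; congr smx.
by apply/rowP => j; rewrite !mxE powRrM.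
Qed.

Lemma mpow1 A : psdmx A -> mpow A 1 = A.
Proof.
move=> /psdmxP[U Uu [d d0 ->]]; rewrite !mpow_smx//; congr smx.
by apply/rowP => j; rewrite !mxE powRr1.
Qed.

Lemma mpow0 A : hermitian A -> mpow A 0 = 1%:M.
Proof.
move=> /hermitian_smxP[U Uu [d ->]]; rewrite !mpow_smx//.
have -> : \row_j powR (d 0 j) 0 = const_mx 1.
  by apply/rowP => j; rewrite !mxE powRr0.
by rewrite smx_const.
Qed.

Lemma mpowD A r s : psdmx A -> 0 <= r -> 0 <= s ->
  mpow A (r + s) = mpow A r *m mpow A s.
Proof.
move=> /psdmxP[U Uu [d d0 ->]] r0 s0; rewrite !mpow_smx// smxM//; congr smx.
by apply/rowP => j; rewrite !mxE powRD_ge0.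
Qed.

(** Positivity of the block matrix [[A^r, A^m], [A^m, A^s]], m = (r+s)/2, tested on the pair (x, y):
    on each eigenvector of A the 2x2 block of scalars has determinant 0. *)
Lemma mpow_amgm A r s x y : psdmx A -> 0 <= r -> 0 <= s ->
  0 <= bform (mpow A r) x x + 2 * bform (mpow A ((r + s) / 2)) x y +
       bform (mpow A s) y y.
Proof.
move=> /psdmxP[U Uu [d d0 ->]] r0 s0; rewrite !mpow_smx// !bform_smx.
rewrite mulr_sumr -!big_split/=; apply: sumr_ge0 => j _; rewrite !mxE.
by apply: wgt_amgm; rewrite ?powR_ge0// powR_mid_sq.
Qed.

(* The diagonal blocks of a positive [[M^r, X], [X, M^s]] bound [X] by their
   geometric mean: an eigenvector of [M^(-m/2) X M^(-m/2)] for an eigenvalue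
   above 1 would contradict positivity. *)
Lemma geometric_mean_bound U d X r s : U \is unitarymx -> (forall j, 0 < d 0 j) ->
    hermitian X ->
    (forall x y, 0 <= bform (smx U (\row_j powR (d 0 j) r)) x x + 2 * bform X x y +
                      bform (smx U (\row_j powR (d 0 j) s)) y y) ->
  forall v, bform X v v <= bform (smx U (\row_j powR (d 0 j) ((r + s) / 2))) v v.
Proof.
move=> Uu d0 hX; set N := fun t => smx U (\row_j powR (d 0 j) t).
rewrite -/(N r) -/(N s) -/(N ((r + s) / 2)) => blk.
have lin (f c : R) : 0 < c ->
    0 <= c + 2 * (-1 * (f * c)) + -1 * (-1 * c) -> f <= 1.
  move=> c0 h; have : 0 <= c * (2 * (1 - f)) by rewrite (le_trans h)//; lra.
  by rewrite pmulr_rge0// pmulr_rge0 ?ltr0n// subr_ge0.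
have hN t : hermitian (N t) by exact: hermitian_smx.
have NM t u : N t *m N u = N (t + u).
  by rewrite /N smxM//; congr smx; apply/rowP => j; rewrite !mxE powRD_gt0.
have N0 : N 0 = 1%:M.
  rewrite /N -[RHS](smx_const 1 Uu); congr smx.
  by apply/rowP => j; rewrite !mxE powRr0.
have Npos t u : u != 0 -> 0 < bform (N t) u u.
  have : pdmx (N t) by apply: pdmx_smx => // j; rewrite mxE powR_gt0.
  by rewrite pdmxE => -[_ /(_ u)].
set m := (r + s) / 2; set Y := N (- (m / 2)) *m X *m N (- (m / 2)).
have hY : hermitian Y by rewrite /hermitian !ctrM hN hX mulmxA.
have Ninv : N (- (m / 2)) *m N (m / 2) = 1%:M by rewrite NM addNr N0.
have Ninv' : N (m / 2) *m N (- (m / 2)) = 1%:M by rewrite NM addrN N0.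
have XE : X = N (m / 2) *m Y *m N (m / 2).
  rewrite /Y !mulmxA Ninv' mul1mx -mulmxA Ninv mulmx1 //.
clearbody Y.
have [V Vu [e YE]] := hermitian_smxP hY.
have e1 j : e 0 j <= 1.
  (* For the eigenvector [w] of [Y], with x = w N(-m/2) and y = - x N(r-m), the three terms of the
     block form are c, -2 (e 0 j) c and c. *)
  set w := row j V; have wY : w *m Y = (e 0 j)%:C *: w by rewrite YE smx_row.
  set c := bform (N (r - m)) w w.
  have c0 : 0 < c by apply: Npos; exact: row_unitarymx_neq0.
  set x := w *m N (- (m / 2)).
  have xX : x *m X = (e 0 j)%:C *: (w *m N (m / 2)).
    by rewrite XE /x !mulmxA -(mulmxA w) Ninv mulmx1 wY scalemxAl.
  have E1 : bform (N r) x x = c.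
    by rewrite /x bform_conj// !NM; congr (bform (N _) _ _); lra.
  have E2 : bform X x (x *m N (r - m)) = e 0 j * c.
    rewrite -[X]mulmx1 bform_mulmx xX bformZl; congr (_ * _).
    rewrite /x -mulmxA NM bform_conj// mulmx1 NM.
    by congr (bform (N _) _ _); rewrite /m; lra.
  have E3 : bform (N s) (x *m N (r - m)) (x *m N (r - m)) = c.
    rewrite /x -mulmxA NM bform_conj// !NM.
    by congr (bform (N _) _ _); rewrite /m; lra.
  have := blk x ((-1)%:C *: (x *m N (r - m))).
  by rewrite !(bformZr, bformZl) E1 E2 E3; exact: lin.
move=> v; rewrite {1}XE -bform_conj// {1}YE.
apply: (@le_trans _ _ (bform (smx V (const_mx 1)) (v *m N (m / 2)) (v *m N (m / 2)))).
  by apply: smx_le => j; rewrite mxE.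
rewrite smx_const// bform_conj// mulmx1 NM.
by rewrite le_eqVlt; apply/orP; left; apply/eqP; congr (bform (N _) _ _); lra.
Qed.

End Powers.

(** * Operator concavity and operator convexity of powers *)

HB.lock Definition wmean (R : realType) (a : R) (n : nat) (A B : 'M[R[i]]_n) :
  'M[R[i]]_n := (1 - a)%:C *: A + a%:C *: B.

Section OperatorConcavity.
Variable R : realType.

(** For [x = 0] the function is constantly 0 near [r > 0]; at exponent 0 it would jump to 1. *)
Lemma powR_continuous_exponent (x r : R) : 0 <= x -> 0 < r ->
  {for r, continuous (fun t => powR x t)}.
Proof.
rewrite le_eqVlt => /orP[/eqP<- r0|x0 _].
  apply: (@cvg_near_cst _ _ _ _ (nbhs r)).
  by near=> t; apply/eqP; rewrite !powR0// gt_eqF//; near: t; exact: lt_nbhsr.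
have -> : (fun t => powR x t) = (fun t => expR (t * ln x)).
  by apply/funext => t; rewrite /powR gt_eqF.
apply: (@continuous_comp _ _ _ (fun t : R => t * ln x) expR).
  exact: mulrr_continuous.
exact: continuous_expR.
Unshelve. all: by end_near. Qed.

Lemma qform_mpow_continuous n (A : 'M[R[i]]_n) (v : 'rV_n) (r : R) :
  psdmx A -> 0 < r -> {for r, continuous (fun t => bform (mpow A t) v v)}.
Proof.
move=> /psdmxP[U Uu [d d0 ->]] r0.
have -> : (fun t => bform (mpow (smx U d) t) v v) =
  (fun t => \sum_j powR (d 0 j) t * wgt (v *m U ^t*) (v *m U ^t*) j).
  apply/funext => t; rewrite mpow_smx// bform_smx.
  by apply: eq_bigr => j _; rewrite mxE.
move: (v *m _) => w; apply: cvg_big => [|j _]; first exact: add_continuous.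
by apply: cvgMr_tmp; exact: powR_continuous_exponent.
Qed.

(** Truncating r 2^m does it once 2^-m < e; the bound on [k] keeps the dyadic inside [0, 1]. *)
Lemma dyadic_dense (r e : R) : 0 <= r <= 1 -> 0 < e ->
  exists m k, (k <= 2 ^ m)%N /\ `|r - k%:R / 2 ^+ m| < e.
Proof.
move=> /andP[r0 r1] e0; set m := Num.bound e^-1.
have pm : 0 < 2 ^+ m :> R by rewrite exprn_gt0.
have em : (2 ^+ m)^-1 < e.
  rewrite -[ltRHS]invrK ltf_pV2 ?posrE ?invr_gt0//.
  have ie : 0 <= e^-1 by rewrite invr_ge0 ltW.
  apply: lt_le_trans (archi_boundP ie) _.
  by rewrite -natrX ler_nat ltnW// ltn_expl.
have t0 : 0 <= r * 2 ^+ m by rewrite mulr_ge0// ltW.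
exists m, (Num.truncn (r * 2 ^+ m)); split.
  rewrite -(ler_nat R); apply: le_trans (_ : r * 2 ^+ m <= _).
    by rewrite truncn_le.
  by rewrite natrX ler_piMl// ltW.
have /andP[lo hi] := truncn_itv t0; apply: le_lt_trans em.
rewrite ger0_norm ?subr_ge0 ?ler_pdivrMr//.
rewrite -[X in X - _](mulfK (lt0r_neq0 pm)) -mulrBl ler_pdivrMr// mulVf ?lt0r_neq0//.
by rewrite lerBlDr (le_trans (ltW hi))// -natr1 addrC.
Qed.

(** A negative value at [r] would persist on a ball around [r], which contains an admissible
    dyadic. *)
Lemma dyadic_ge0 (f : R -> R) (r : R) : 0 <= r <= 1 ->
    {for r, continuous f} ->
  (forall m k, (k <= 2 ^ m)%N -> 0 <= f (k%:R / 2 ^+ m)) -> 0 <= f r.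
Proof.
move=> r01 fc fd; rewrite leNgt; apply/negP => fr.
have : \forall t \near r, f t < 0 by apply: (cvgr_lt _ fc).
case/nbhs_ballP => e /= e0 he.
have [m [k [km ke]]] := dyadic_dense r01 e0.
by have := he _ ke; rewrite ltNge fd.
Qed.

Section Mean.
Variables (a : R) (n : nat).
Hypotheses (a0 : 0 <= a) (a1 : a <= 1).
Implicit Types (A B M : 'M[R[i]]_n) (x y v : 'rV[R[i]]_n) (r s : R).

Lemma bform_wmean A B x y :
  bform (wmean a A B) x y = (1 - a) * bform A x y + a * bform B x y.
Proof. by rewrite wmean.unlock bformDm !bformZm. Qed.

Lemma hermitian_wmean A B : hermitian A -> hermitian B -> hermitian (wmean a A B).
Proof. by move=> hA hB; rewrite wmean.unlock; apply: hermitianD; apply: hermitianZ. Qed.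

Lemma psdmx_wmean A B : psdmx A -> psdmx B -> psdmx (wmean a A B).
Proof.
rewrite !psdmxE => -[hA A0] [hB B0]; split; first exact: hermitian_wmean.
by move=> v; rewrite bform_wmean addr_ge0// mulr_ge0// subr_ge0.
Qed.

Lemma wmean_amgm A B r s x y : psdmx A -> psdmx B -> 0 <= r -> 0 <= s ->
  0 <= bform (wmean a (mpow A r) (mpow B r)) x x +
       2 * bform (wmean a (mpow A ((r + s) / 2)) (mpow B ((r + s) / 2))) x y +
       bform (wmean a (mpow A s) (mpow B s)) y y.
Proof.
move=> A0 B0 r0 s0; rewrite !bform_wmean.
have lin (p1 p2 p3 q1 q2 q3 : R) : 0 <= p1 + 2 * p2 + p3 -> 0 <= q1 + 2 * q2 + q3 ->
    0 <= (1 - a) * p1 + a * q1 + 2 * ((1 - a) * p2 + a * q2) + ((1 - a) * p3 + a * q3).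
  move=> P Q; have -> : (1 - a) * p1 + a * q1 + 2 * ((1 - a) * p2 + a * q2) +
    ((1 - a) * p3 + a * q3) =
    (1 - a) * (p1 + 2 * p2 + p3) + a * (q1 + 2 * q2 + q3) by ring.
  by rewrite addr_ge0// mulr_ge0// subr_ge0.
by apply: lin; exact: mpow_amgm.
Qed.

(** The Loewner order on the level of quadratic forms; between Hermitian matrices it agrees with
    [loewner_le]. *)
Definition qle A B := forall v, bform A v v <= bform B v v.

Lemma qle_trans A B M : qle A B -> qle B M -> qle A M.
Proof. by move=> AB BM v; apply: le_trans (AB v) (BM v). Qed.

(** Induction on the level [m]: exponent 0 gives the identity on both sides, exponent 1 is the
    hypothesis, and midpoints come from [geometric_mean_bound], whose inverse powers exist because
    [d] is positive. *)
Lemma wmean_dyadic_le A B (U : 'M[R[i]]_n) (d : 'rV[R]_n) m k :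
    psdmx A -> psdmx B -> U \is unitarymx -> (forall j, 0 < d 0 j) ->
    qle (wmean a A B) (smx U d) -> (k <= 2 ^ m)%N ->
  let r := k%:R / 2 ^+ m in
  qle (wmean a (mpow A r) (mpow B r)) (mpow (smx U d) r).
Proof.
move=> A0 B0 Uu d0 AB /=.
have M0 : psdmx (smx U d) by apply: psdmx_smx => j; exact: ltW.
elim: m k => [|m IH] k km.
  case: k km => [|[|//]] _; rewrite expr0 divr1.
    move=> v; rewrite !mpow0; [|exact: (proj1 M0)..|exact: (proj1 B0)|exact: (proj1 A0)].
    by rewrite bform_wmean; move: (bform _ v v) => c; lra.
  by move=> v; rewrite (mpow1 A0) (mpow1 B0) (mpow1 M0); exact: AB.
have pm : 2 ^+ m != 0 :> R by rewrite expf_neq0// pnatr_eq0.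
have [l [l' [lm lm' kE]]] : exists l l', [/\ (l <= 2 ^ m)%N, (l' <= 2 ^ m)%N &
    k%:R / 2 ^+ m.+1 = (l%:R / 2 ^+ m + l'%:R / 2 ^+ m) / 2 :> R].
  (* The lower and upper halves of [k] add up to [k], so a dyadic of level [m.+1] is the midpoint of
     two of level [m]. *)
  exists k./2, (uphalf k); split.
  - by rewrite -[leqRHS](doubleK (2 ^ m)%N) half_leq// -mul2n -expnS.
  - by rewrite leq_uphalf_double -mul2n -expnS.
  - rewrite -mulrDl -natrD addnC uphalf_half -addnA addnn odd_double_half exprS.
    by field.
rewrite kE mpow_smx//.
have := IH _ lm; have := IH _ lm'; rewrite !mpow_smx//.
set r := l%:R / _; set s := l'%:R / _ => Hs Hr.
have r0 : 0 <= r by rewrite divr_ge0 ?exprn_ge0.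
have s0 : 0 <= s by rewrite divr_ge0 ?exprn_ge0.
apply: geometric_mean_bound => //.
  by apply: hermitian_wmean; apply: hermitian_mpow; [case: A0|case: B0].
(* By induction the diagonal blocks may be replaced by the larger powers of the dominating matrix,
   which preserves positivity. *)
have lin (p q p' q' t : R) : 0 <= p + t + q -> p <= p' -> q <= q' -> 0 <= p' + t + q'.
  by lra.
by move=> x y; apply: lin (wmean_amgm x y A0 B0 r0 s0) (Hr x) (Hs y).
Qed.

(* Operator monotonicity and operator concavity of [t^r] in one statement. *)
Lemma wmean_powR_le A B M r : psdmx A -> psdmx B -> psdmx M -> 0 <= r <= 1 ->
  qle (wmean a A B) M ->
  qle (wmean a (mpow A r) (mpow B r)) (mpow M r).
Proof.
move=> A0 B0 M0 r01 AB; have /andP[r0 r1] := r01.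
(* Exponent 0 is treated apart, as continuity in the exponent is available at positive exponents. *)
have [rE|rn0] := eqVneq r 0.
  move=> v; rewrite rE !mpow0; [|exact: (proj1 M0)..|exact: (proj1 B0)|exact: (proj1 A0)].
  by rewrite bform_wmean; move: (bform _ v v) => c; lra.
have rp : 0 < r by rewrite lt_def rn0.
have [U Uu [d d0 ME]] := psdmxP M0.
(* A shift of the eigenvalues by [e] makes the dominating matrix invertible; continuity then passes
   from dyadic exponents to [r]. *)
have reg e : 0 < e -> qle (wmean a (mpow A r) (mpow B r))
    (mpow (smx U (d + const_mx e)) r).
  move=> e0 v; have de j : 0 < (d + const_mx e) 0 j by rewrite !mxE ltr_wpDl.
  have Me : psdmx (smx U (d + const_mx e)) by apply: psdmx_smx => j; exact: ltW.
  have ABe : qle (wmean a A B) (smx U (d + const_mx e)).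
    apply: qle_trans AB _ => w; rewrite ME; apply: smx_le => j.
    by rewrite !mxE lerDl ltW.
  rewrite -subr_ge0.
  apply: (@dyadic_ge0 (fun t => bform (mpow (smx U (d + const_mx e)) t) v v -
    bform (wmean a (mpow A t) (mpow B t)) v v)) => // [|m k km].
    apply: cvgB; first exact: qform_mpow_continuous.
    have -> : (fun t => bform (wmean a (mpow A t) (mpow B t)) v v) =
      (fun t => (1 - a) * bform (mpow A t) v v + a * bform (mpow B t) v v).
      by apply/funext => t; rewrite bform_wmean.
    rewrite bform_wmean.
    by apply: cvgD; apply: cvgMl_tmp; exact: qform_mpow_continuous.
  by rewrite subr_ge0; exact: wmean_dyadic_le.
move=> v; apply/ler_addgt0Pr => e e0.
have K0 : 0 <= bform 1%:M v v.
  by rewrite -(smx_const 1 Uu); have := psdmx_smx U (d := const_mx 1);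
    rewrite psdmxE => -[j|_]; [rewrite mxE|apply].
set K := bform _ v v in K0.
(* [g] is chosen with [g * K <= e]. A shift of the eigenvalues by g^(1/r) raises their r-th powers
   by at most g, since t^r is subadditive. *)
set g := e / (K + 1); have g0 : 0 < g by rewrite divr_gt0// ltr_wpDl.
have gK : g * K <= e.
  by rewrite /g mulrAC ler_pdivrMr ?ltr_wpDl// ler_wpM2l ?(ltW e0)// lerDl.
apply: le_trans (reg (powR g r^-1) (powR_gt0 _ g0) v) _.
apply: le_trans (_ : _ <= bform (mpow M r) v v + g * K) _; last by rewrite lerD2l.
rewrite ME !mpow_smx// /K -bformZm -(smx_const 1 Uu) smxZ -bformDm smxD.
apply: smx_le => j; rewrite !mxE mulr1.
apply: le_trans (powR_add_le (d0 j) (powR_gt0 _ g0) r01) _.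
by rewrite -powRrM mulVf// powRr1// ltW.
Qed.

(** The block with exponents s and 2-s has middle exponent 1. Let M be the mean of A and B, and test
    the block on v and - v M^(s-1): by concavity of t^(2-s) the last term is at most the form of M^s
    at v, and the middle term is exactly -2 times that form. *)
Lemma mpow_wmean_le A B s : psdmx A -> psdmx B -> 1 <= s <= 2 ->
  qle (mpow (wmean a A B) s) (wmean a (mpow A s) (mpow B s)).
Proof.
move=> A0 B0 /andP[s1 s2] v; set M := wmean a A B.
have M0 : psdmx M by exact: psdmx_wmean.
have lin (b c e : R) :
    0 <= b + 2 * (-1 * c) + -1 * (-1 * e) -> e <= c -> c <= b by lra.
have s2' : 0 <= 2 - s <= 1 by apply/andP; split; lra.
have s0 : 0 <= s by lra.
have t0 : 0 <= s - 1 by lra.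
have /andP[u0 _] := s2'.
have hN : hermitian (mpow M (s - 1)) by exact: hermitian_mpow (proj1 M0).
have := wmean_powR_le A0 B0 M0 s2' (fun w => lexx _) (v *m mpow M (s - 1)).
have := wmean_amgm v ((-1)%:C *: (v *m mpow M (s - 1))) A0 B0 s0 u0.
have -> : (s + (2 - s)) / 2 = 1 by lra.
rewrite (mpow1 A0) (mpow1 B0) -/M !(bformZr, bformZl).
rewrite (bform_conj (mpow M (2 - s)))// -bform_mulmxr// -{1}(mpow1 M0).
rewrite -!mpowD//; last by rewrite addr_ge0.
have -> : 1 + (s - 1) = s by lra.
have -> : s - 1 + (2 - s) + (s - 1) = s by lra.
exact: lin.
Qed.

End Mean.
End OperatorConcavity.

(** * Sufficiency of the conditions on the exponents *)

Section Sufficiency.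
Variables (R : realType) (a : R) (n : nat).
Hypotheses (a0 : 0 <= a) (a1 : a <= 1).
Implicit Types (A B X Y : 'M[R[i]]_n).

Lemma powmeanE p A B :
  powmean a p A B = mpow (wmean a (mpow A p) (mpow B p)) p^-1.
Proof. by rewrite wmean.unlock mpow.unlock. Qed.

Lemma loewner_leP X Y : hermitian X -> hermitian Y ->
  loewner_le X Y <-> qle X Y.
Proof.
move=> hX hY; split=> [|XY]; rewrite /loewner_le psdmxE.
  by move=> [_ XY] v; rewrite -subr_ge0 -bformBm.
split=> [|v]; first exact: hermitianB.
by rewrite bformBm subr_ge0.
Qed.

Lemma hermitian_powmean p A B : psdmx A -> psdmx B -> hermitian (powmean a p A B).
Proof.
move=> A0 B0; rewrite powmeanE; apply: hermitian_mpow.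
by apply: hermitian_wmean; apply: hermitian_mpow; [case: A0|case: B0].
Qed.

(** Operator monotonicity is the case of two equal arguments in [wmean_powR_le]. *)
Lemma mpow_le A B r : psdmx A -> psdmx B -> 0 <= r <= 1 -> qle A B ->
  qle (mpow A r) (mpow B r).
Proof.
move=> A0 B0 r01 AB v.
have -> : bform (mpow A r) v v = bform (wmean a (mpow A r) (mpow A r)) v v.
  by rewrite bform_wmean; move: (bform _ v v) => c; ring.
apply: wmean_powR_le => // w; rewrite bform_wmean.
by rewrite -mulrDl subrK mul1r.
Qed.

(** Concavity of t^(p/q) on A^q and B^q bounds the mean of the p-th powers by a power of the mean of
    the q-th powers; the exponent 1/p <= 1 is operator monotone. *)
Lemma powmean_le_ge1 p q A B : psdmx A -> psdmx B -> 1 <= p -> p <= q ->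
  qle (powmean a p A B) (powmean a q A B).
Proof.
move=> A0 B0 p1 pq; rewrite !powmeanE.
have p0 : 0 < p by rewrite (lt_le_trans ltr01).
have q0 : 0 < q by rewrite (lt_le_trans p0).
have r01 : 0 <= p / q <= 1 by rewrite divr_ge0 ?ler_pdivrMr ?mul1r// ltW.
have Aq := psdmx_mpow q A0; have Bq := psdmx_mpow q B0.
have Mq := psdmx_wmean a0 a1 Aq Bq.
have pqE : q * (p / q) = p by rewrite mulrCA divff ?mulr1// gt_eqF.
have qpE : p / q / p = q^-1 by rewrite mulrAC divff ?mul1r// gt_eqF.
rewrite -qpE -(mpow_mpow _ _ Mq); apply: mpow_le.
- exact: (psdmx_wmean a0 a1 (psdmx_mpow p A0) (psdmx_mpow p B0)).
- exact: psdmx_mpow.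
- by rewrite invr_ge0 ltW//= invf_le1.
- by rewrite -pqE -(mpow_mpow _ _ A0) -(mpow_mpow _ _ B0) pqE; exact: wmean_powR_le.
Qed.

(** Operator convexity of t^(1/p), where 1 <= 1/p <= 2, applied to A^p and B^p. *)
Lemma powmean_le_arith p A B : psdmx A -> psdmx B -> 2^-1 <= p -> p <= 1 ->
  qle (powmean a p A B) (powmean a 1 A B).
Proof.
move=> A0 B0 p2 p1; have p0 : 0 < p by rewrite (lt_le_trans _ p2)// invr_gt0.
have M0 := psdmx_wmean a0 a1 A0 B0.
rewrite !powmeanE invr1 !mpow1 ?mpow1//.
have {2}-> : A = mpow (mpow A p) p^-1.
  by rewrite mpow_mpow// divff ?mpow1// gt_eqF.
have {2}-> : B = mpow (mpow B p) p^-1.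
  by rewrite mpow_mpow// divff ?mpow1// gt_eqF.
apply: (mpow_wmean_le a0 a1 (psdmx_mpow p A0) (psdmx_mpow p B0)).
by rewrite invf_ge1// p1 invf_ple ?posrE.
Qed.

Lemma powmean_le_sufficient p q A B : psdmx A -> psdmx B ->
  p = q \/ (1 <= p /\ p < q) \/ (2^-1 <= p /\ p < 1 /\ 1 <= q) ->
  loewner_le (powmean a p A B) (powmean a q A B).
Proof.
move=> A0 B0 pq; apply/loewner_leP; [exact: hermitian_powmean..|].
case: pq => [->|[[p1 /ltW pq]|[p2 [/ltW p1 q1]]]].
- by move=> v.
- exact: powmean_le_ge1.
(* The weighted arithmetic mean, exponent 1, lies between the two means. *)
- by apply: qle_trans (powmean_le_arith A0 B0 p2 p1) _; exact: powmean_le_ge1.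
Qed.

End Sufficiency.

(** * Bounds for powers of a matrix by polynomials in it *)

Section FunctionalBounds.
Variables (R : realType) (n : nat).
Implicit Types (P X Y : 'M[R[i]]_n) (v : 'rV[R[i]]_n) (s t x y : R).

Lemma bform1_mul X v : hermitian X ->
  bform 1%:M (v *m X) (v *m X) = bform (X *m X) v v.
Proof. by move=> hX; rewrite bform_conj// mulmx1. Qed.

Lemma eigenvalue_le (U : 'M[R[i]]_n) (d : 'rV[R]_n) c : U \is unitarymx ->
  qle (smx U d) c%:C%:M -> forall j, d 0 j <= c.
Proof.
move=> Uu dc j; have := dc (row j U).
by rewrite bform_smx_row// -(smx_const c Uu) bform_smx_row// mxE.
Qed.

(** The scalar bound is x^s <= t^s + t^(s-2) x^2: the first term suffices for x <= t, the second for
    x > t. *)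
Lemma mpow_upper_small Y s t v : psdmx Y -> 0 < t -> 0 <= s <= 2 ->
  bform (mpow Y s) v v <=
    powR t s * bform 1%:M v v + powR t (s - 2) * bform 1%:M (v *m Y) (v *m Y).
Proof.
move=> Y0 t0 /andP[s0 s2]; rewrite (bform1_mul _ (proj1 Y0)).
have [U Uu [d d0 ->]] := psdmxP Y0.
rewrite mpow_smx// smxM// -(smx_const 1 Uu) -!bformZm !smxZ -bformDm smxD.
apply: smx_le => j; rewrite !mxE mulr1; move: (d 0 j) (d0 j) => x x0.
have [xt|tx] := leP x t.
  rewrite (le_trans (ge0_ler_powR _ _ _ xt)) ?nnegrE// ?(ltW t0)//.
  by rewrite lerDl mulr_ge0 ?powR_ge0// mulr_ge0.
have xp : 0 < x by exact: lt_trans tx.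
have -> : powR x s = powR x (s - 2) * (x * x).
  by rewrite -expr2 -powR_mulrn// -powRD_gt0//; congr powR; lra.
rewrite -[leLHS]add0r lerD ?powR_ge0// ler_wpM2r ?mulr_ge0//.
have -> : s - 2 = - (2 - s) by lra.
by rewrite !powRN lef_pV2 ?posrE ?powR_gt0// ge0_ler_powR ?nnegrE ?subr_ge0// ltW.
Qed.

Lemma mpow_upper_sq Y s v : psdmx Y -> 2 <= s -> qle Y 1%:M ->
  bform (mpow Y s) v v <= bform 1%:M (v *m Y) (v *m Y).
Proof.
move=> Y0 s2; rewrite (bform1_mul _ (proj1 Y0)).
have [U Uu [d d0 ->]] := psdmxP Y0; move=> /(@eigenvalue_le U d 1 Uu) d1.
rewrite mpow_smx// smxM//.
apply: smx_le => j; rewrite !mxE; move: (d 0 j) (d0 j) (d1 j) => x x0 x1.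
rewrite -expr2 -powR_mulrn//; have [->|xn0] := eqVneq x 0.
  by rewrite !powR0 ?pnatr_eq0// gt_eqF// (lt_le_trans _ s2).
by apply: ger_powR => //; rewrite lt_def xn0 x0.
Qed.

(** As s <= 2, the factor x^(s-2) is smallest at the largest admissible eigenvalue x = c. *)
Lemma mpow_lower_small X s c v : psdmx X -> 0 < c -> s <= 2 -> 0 < s -> qle X c%:C%:M ->
  powR c (s - 2) * bform 1%:M (v *m X) (v *m X) <= bform (mpow X s) v v.
Proof.
move=> X0 c0 s2 s0; rewrite (bform1_mul _ (proj1 X0)).
have [U Uu [d d0 ->]] := psdmxP X0; move=> /(eigenvalue_le Uu) dc.
rewrite mpow_smx// smxM// -!bformZm smxZ.
apply: smx_le => j; rewrite !mxE; move: (d 0 j) (d0 j) (dc j) => x x0 xc.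
have [->|xn0] := eqVneq x 0; first by rewrite mulr0 mulr0 powR_ge0.
have xp : 0 < x by rewrite lt_def xn0.
have -> : powR x s = powR x (s - 2) * (x * x).
  by rewrite -expr2 -powR_mulrn// -powRD_gt0//; congr powR; lra.
rewrite ler_wpM2r ?mulr_ge0//; have -> : s - 2 = - (2 - s) by lra.
by rewrite !powRN lef_pV2 ?posrE ?powR_gt0// ge0_ler_powR ?nnegrE ?subr_ge0// ltW.
Qed.

(** The scalar bound is x^s >= c^(s-2) x^2 (x - c) on [0, 1]: the right side is nonpositive for x <=
    c, and beyond c both x^(s-2) >= c^(s-2) and x - c <= 1 hold. It discards the eigenvalues below
    c. *)
Lemma mpow_lower_cubic X s c v : psdmx X -> 0 < c -> 2 <= s -> qle X 1%:M ->
  powR c (s - 2) * (bform X (v *m X) (v *m X) - c * bform 1%:M (v *m X) (v *m X))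
    <= bform (mpow X s) v v.
Proof.
move=> X0 c0 s2; rewrite (bform1_mul _ (proj1 X0)) (bform_conj _ _ _ _ (proj1 X0)).
have [U Uu [d d0 ->]] := psdmxP X0; move=> /(@eigenvalue_le U d 1 Uu) d1.
rewrite mpow_smx// !smxM// -!bformZm -bformBm -scaleNr.
rewrite (_ : - c%:C = (- c)%:C); last by rewrite raddfN.
rewrite smxZ smxD -bformZm smxZ.
apply: smx_le => j; rewrite !mxE; move: (d 0 j) (d0 j) (d1 j) => x x0 x1.
rewrite (_ : x * x * x + - c * (x * x) = x * x * (x - c)); last by ring.
have [xc|cx] := leP x c.
  apply: le_trans (powR_ge0 _ _).
  by rewrite mulr_ge0_le0 ?powR_ge0// mulr_ge0_le0 ?mulr_ge0// subr_le0.
have xp : 0 < x by exact: lt_trans cx.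
have -> : powR x s = powR x (s - 2) * (x * x).
  by rewrite -expr2 -powR_mulrn// -powRD_gt0//; congr powR; lra.
apply: ler_pM; rewrite ?powR_ge0//.
- by rewrite !mulr_ge0// subr_ge0 ltW.
- by rewrite ge0_ler_powR ?nnegrE ?subr_ge0// ltW.
- by rewrite ler_piMr ?mulr_ge0// (le_trans _ x1)// gerDl oppr_le0 ltW.
Qed.

(** * Matrices with at most two eigenvalues, built from a projection *)

Definition twoval P x y : 'M[R[i]]_n := x%:C *: P + y%:C *: (1%:M - P).

Section Projection.
Variable P : 'M[R[i]]_n.
Hypotheses (hP : hermitian P) (PP : P *m P = P).

(** One eigenbasis serves all [x] and [y]: idempotence forces the eigenvalues of [P] into 0 and 1,
    and [b] marks those equal to 1. *)
Lemma twoval_smx : exists2 U, U \is unitarymx &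
  exists b : 'I_n -> bool,
    forall x y, twoval P x y = smx U (\row_j if b j then x else y).
Proof.
have [U Uu [d PE]] := hermitian_smxP hP; exists U => //.
have dd j : d 0 j * d 0 j = d 0 j.
  have := congr1 (fun M => bform M (row j U) (row j U)) PP.
  by rewrite /= PE smxM// !bform_smx_row// mxE.
exists (fun j => d 0 j == 1) => x y; rewrite /twoval -(smx_const 1 Uu) PE.
rewrite (_ : _ - _ = smx U (const_mx 1) + (-1)%:C *: smx U d); last first.
  by rewrite rmorphN rmorph1 scaleN1r.
rewrite !smxZ smxD !smxZ smxD; congr smx; apply/rowP => j; rewrite !mxE.
case: eqVneq => [->|dn1]; first by ring.
have -> : d 0 j = 0; last by ring.
have := dd j; rewrite -[RHS]mulr1 => /eqP; rewrite -subr_eq0 -mulrBr mulf_eq0.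
by rewrite subr_eq0 (negPf dn1) orbF => /eqP.
Qed.

Lemma mpow_twoval x y s :
  mpow (twoval P x y) s = twoval P (powR x s) (powR y s).
Proof.
have [U Uu [b E]] := twoval_smx; rewrite !E mpow_smx//; congr smx.
by apply/rowP => j; rewrite !mxE; case: (b j).
Qed.

Lemma pdmx_twoval x y : 0 < x -> 0 < y -> pdmx (twoval P x y).
Proof.
move=> x0 y0; have [U Uu [b ->]] := twoval_smx; apply: pdmx_smx => // j.
by rewrite mxE; case: (b j).
Qed.

Lemma twoval_le x y c : x <= c -> y <= c -> qle (twoval P x y) c%:C%:M.
Proof.
move=> xc yc v; have [U Uu [b ->]] := twoval_smx; rewrite -(smx_const c Uu).
by apply: smx_le => j; rewrite !mxE; case: (b j).
Qed.

End Projection.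

Lemma wmean_scalar_le (a c : R) X Y : 0 <= a <= 1 ->
  qle X c%:C%:M -> qle Y c%:C%:M -> qle (wmean a X Y) c%:C%:M.
Proof.
move=> /andP[a0 a1] Xc Yc v; rewrite bform_wmean.
have lin (p q r : R) : p <= r -> q <= r -> (1 - a) * p + a * q <= r.
  move=> pr qr; have -> : r = (1 - a) * r + a * r by ring.
  by rewrite lerD// ler_wpM2l// subr_ge0.
exact: lin.
Qed.

Lemma mpow_scalar c s : mpow (c%:C%:M : 'M[R[i]]_n) s = (powR c s)%:C%:M.
Proof.
have U1 : (1%:M : 'M[R[i]]_n) \is unitarymx.
  by apply/unitarymxP; rewrite mul1mx hermitian1.
rewrite -(smx_const c U1) mpow_smx// -(smx_const _ U1); congr smx.
by apply/rowP => j; rewrite !mxE.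
Qed.

Lemma pdmx_scalar c : 0 < c -> pdmx (c%:C%:M : 'M[R[i]]_n).
Proof.
have U1 : (1%:M : 'M[R[i]]_n) \is unitarymx.
  by apply/unitarymxP; rewrite mul1mx hermitian1.
by move=> c0; rewrite -(smx_const c U1); apply: pdmx_smx => // j; rewrite mxE.
Qed.

End FunctionalBounds.

(** * Real symmetric 2x2 matrices and real test vectors *)

Section TwoByTwo.
Variable R : realType.
Implicit Types (a b c x y t u C : R).

(** Supplies the small parameter of each counterexample. *)
Lemma powR_small u C : 0 < u -> 0 < C -> exists t, [/\ 0 < t, t <= 1 & powR t u <= C].
Proof.
move=> u0 C0; exists (Num.min 1 (powR C u^-1)); split.
- by rewrite lt_min ltr01 powR_gt0.
- by rewrite ge_min lexx.
apply: (@le_trans _ _ (powR (powR C u^-1) u)).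
  apply: ge0_ler_powR; rewrite ?nnegrE ?powR_ge0 ?(ltW u0)//.
    by rewrite le_min ler01 powR_ge0.
  by rewrite ge_min lexx orbT.
by rewrite -powRrM mulVf ?gt_eqF// powRr1// ltW.
Qed.

Definition sym2 a b c : 'M[R[i]]_2 :=
  \matrix_(i, j) (if i == 0 then if j == 0 then a else b
                  else if j == 0 then b else c)%:C.

Definition rv2 x y : 'rV[R[i]]_2 := \row_j (if j == 0 then x else y)%:C.

Lemma hermitian_sym2 a b c : hermitian (sym2 a b c).
Proof.
rewrite /hermitian; apply/matrixP => i j; rewrite !mxE.
by case: eqP; case: eqP => _ _; exact: conjC_real.
Qed.

Lemma rv2_mul_sym2 x y a b c :
  rv2 x y *m sym2 a b c = rv2 (x * a + y * b) (x * b + y * c).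
Proof.
apply/rowP => j; rewrite !mxE !big_ord_recl big_ord0 !mxE addr0/=.
by case: eqP => _; rewrite -!rmorphM -rmorphD.
Qed.

Lemma bform1_rv2 x y u t : bform 1%:M (rv2 x y) (rv2 u t) = x * u + y * t.
Proof.
rewrite bform.unlock mulmx1 mxE !big_ord_recl big_ord0 !mxE addr0 ReD/=.
by rewrite !(mulr0, mul0r, oppr0, subr0).
Qed.

Lemma bform_sym2 a b c x y u t :
  bform (sym2 a b c) (rv2 x y) (rv2 u t) =
  (x * a + y * b) * u + (x * b + y * c) * t.
Proof. by rewrite -[sym2 a b c]mulmx1 bform_mulmx rv2_mul_sym2 bform1_rv2. Qed.

Lemma sym2_idem a b c : a * a + b * b = a -> a * b + b * c = b ->
  b * b + c * c = c -> sym2 a b c *m sym2 a b c = sym2 a b c.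
Proof.
move=> h1 h2 h3; apply/matrixP => i j.
rewrite !mxE !big_ord_recl big_ord0 !mxE addr0/= -!rmorphM -rmorphD.
congr (_%:C); case: eqP; case: eqP => _ _ //.
by rewrite (mulrC b a) (mulrC c b).
Qed.

Lemma twoval_sym2 a b c x y : twoval (sym2 a b c) x y =
  sym2 (x * a + y * (1 - a)) (x * b - y * b) (x * c + y * (1 - c)).
Proof.
apply/matrixP => i j; rewrite !mxE.
have -> : (i == j) = ((i == 0) == (j == 0)).
  by case: i j => [[|[|//]] ?] [[|[|//]] ?].
by case: (i == 0); case: (j == 0); rewrite /= ?mulr1n ?mulr0n;
  rewrite !(rmorphD, rmorphN, rmorphM, rmorph1)//; ring.
Qed.

Lemma wmean_sym2 w a b c x y t :
  wmean w (sym2 a b c) (sym2 x y t) =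
  sym2 ((1 - w) * a + w * x) ((1 - w) * b + w * y) ((1 - w) * c + w * t).
Proof.
rewrite wmean.unlock; apply/matrixP => i j; rewrite !mxE -!rmorphM -rmorphD.
by case: eqP; case: eqP.
Qed.

End TwoByTwo.

(** * Necessity of p <= q, by scalar matrices *)

Section Necessity.
Variables (R : realType) (a : R).
Hypotheses (a0 : 0 < a) (a1 : a < 1).

Implicit Types p q s t d y : R.

Let a01 : 0 <= a <= 1. Proof. by rewrite !ltW. Qed.

Let powR1l s : powR 1 s = 1 :> R. Proof. by rewrite powR1. Qed.

Definition le2 (p q : R) := forall A B : 'M[R[i]]_2, pdmx A -> pdmx B ->
  loewner_le (powmean a p A B) (powmean a q A B).

Lemma le2_qle p q (A B : 'M[R[i]]_2) : le2 p q -> pdmx A -> pdmx B ->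
  qle (mpow (wmean a (mpow A p) (mpow B p)) p^-1)
      (mpow (wmean a (mpow A q) (mpow B q)) q^-1).
Proof.
move=> h A0 B0; rewrite -!powmeanE.
have A0' := pdmx_psdmx A0; have B0' := pdmx_psdmx B0.
apply/(loewner_leP (hermitian_powmean a p A0' B0') (hermitian_powmean a q A0' B0')).
exact: h.
Qed.

Lemma wmean_scalar n (c d : R) :
  wmean a c%:C%:M d%:C%:M = ((1 - a) * c + a * d)%:C%:M :> 'M[R[i]]_n.
Proof.
by rewrite wmean.unlock !scale_scalar_mx -raddfD /= -!rmorphM -rmorphD.
Qed.

(** Tested on the scalar matrices 1 and b: as b tends to 0 the inequality becomes x^(1/p) <= x^(1/q)
    with x = 1 - a in (0, 1), which fails for q < p. *)
Lemma le2_order p q : 0 < p -> 0 < q -> le2 p q -> p <= q.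
Proof.
move=> p0 q0 h; rewrite leNgt; apply/negP => qp.
have lin (u v w z : R) : 0 < u - v -> z <= (u - v) / 2 -> w <= z ->
    u <= v + w -> False by lra.
have x0 : 0 < 1 - a by rewrite subr_gt0.
set x := 1 - a in x0 *.
have x1 : x < 1 by rewrite /x ltrBlDr ltrDl.
have r1 : 0 < 1 - q / p by rewrite subr_gt0 ltr_pdivrMr// mul1r.
have xx : x < powR x (q / p).
  have {1}-> : x = powR x (q / p) * powR x (1 - q / p).
    by rewrite -powRD_gt0// addrC subrK powRr1// ltW.
  rewrite gtr_pMr ?powR_gt0//.
  rewrite -[ltRHS](powR1l (1 - q / p)).
  by rewrite gt0_ltr_powR ?nnegrE ?ltW.
have xx0 : 0 < powR x (q / p) - x by rewrite subr_gt0.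
have C0 : 0 < (powR x (q / p) - x) / 2 by rewrite divr_gt0.
(* b^q is at most half of the gap x^(q/p) - x, which the term a b^q would have to fill. *)
have [b [b0 b1 bC]] := powR_small q0 C0.
have E (c d : R) : bform c%:C%:M (rv2 1 0) (rv2 1 0) <=
    bform d%:C%:M (rv2 1 0) (rv2 1 0) -> c <= d.
  rewrite -(scalemx1 2 c%:C) -(scalemx1 2 d%:C) !bformZm bform1_rv2.
  by rewrite mulr0 addr0 !mulr1.
have := le2_qle h (@pdmx_scalar R 2 1 ltr01) (pdmx_scalar 2 b0) (rv2 1 0).
rewrite !mpow_scalar !wmean_scalar !mpow_scalar !powR1 mulr1 -/x.
move/E => le1.
set f := powR b p in le1; set g := powR b q in bC le1.
have f0 : 0 <= f by exact: powR_ge0.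
have g0 : 0 <= g by exact: powR_ge0.
have ag : a * g <= g by rewrite ler_piMl// ltW.
have [x0' a0'] := (ltW x0, ltW a0).
have xf : 0 <= x + a * f by rewrite addr_ge0// mulr_ge0.
have xg : 0 <= x + a * g by rewrite addr_ge0// mulr_ge0.
have le2 : powR x p^-1 <= powR (x + a * f) p^-1.
  apply: ge0_ler_powR; rewrite ?nnegrE ?invr_ge0 ?(ltW p0) ?(ltW x0)//.
  by rewrite lerDl mulr_ge0.
have := le_trans le2 le1 => /(ge0_ler_powR (ltW q0)).
rewrite !nnegrE !powR_ge0 => /(_ isT isT); rewrite -!powRrM.
rewrite mulVf ?gt_eqF// powRr1// mulrC => le3.
exact: lin xx0 bC ag le3.
Qed.

(** * Necessity of 1/2 <= p, by a perturbation of size d *)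

Let P0 : 'M[R[i]]_2 := sym2 1 0 0.
Let hP0 : hermitian P0. Proof. exact: hermitian_sym2. Qed.
Let P0P0 : P0 *m P0 = P0. Proof. by apply: sym2_idem; ring. Qed.

(** The orthogonal projection onto the line of (1, 1). *)
Let Q0 : 'M[R[i]]_2 := sym2 2^-1 2^-1 2^-1.
Let hQ0 : hermitian Q0. Proof. exact: hermitian_sym2. Qed.
Let Q0Q0 : Q0 *m Q0 = Q0. Proof. by apply: sym2_idem; field. Qed.

(** The row e2 X has norm at most d and first entry a d / 4, and the first diagonal entry of X is at
    least 1 - a. So the form of X at e2 X is at least (a d / 4)^2 (1 - a) = 2 c d^2, and the cubic
    bound with threshold [c] keeps c d^2 of it. *)
Lemma half_lower c s d : c = (a / 4) ^+ 2 * (1 - a) / 2 ->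
    0 < d -> d <= 1 -> 2 <= s ->
  powR c (s - 2) * (c * d ^+ 2) <=
  bform (mpow (wmean a (twoval P0 1 d) (twoval Q0 d (d / 2))) s) (rv2 0 1) (rv2 0 1).
Proof.
move=> cE d0 d1 s2; set X := wmean _ _ _.
have c0 : 0 < c by rewrite cE !(divr_gt0, mulr_gt0, exprn_gt0, subr_gt0).
have d2 : 0 < d / 2 by rewrite divr_gt0.
have X0 : psdmx X.
  by apply: psdmx_wmean; rewrite ?(ltW a0) ?(ltW a1)//; apply: pdmx_psdmx;
    apply: pdmx_twoval.
have X1 : qle X 1%:M.
  by apply: (@wmean_scalar_le _ _ _ 1) => //; apply: twoval_le => //; lra.
apply: le_trans (mpow_lower_cubic (rv2 0 1) X0 c0 s2 X1).
rewrite ler_wpM2l ?powR_ge0//.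
have -> : X = sym2 (1 - a + 3 / 4 * a * d) (a * d / 4) ((1 - a) * d + 3 / 4 * a * d).
  by rewrite /X !twoval_sym2 wmean_sym2; congr sym2; field.
rewrite rv2_mul_sym2 bform_sym2 bform1_rv2 -subr_ge0 cE.
set e := (X in 0 <= X).
(* With u = a/4 every summand is nonnegative, because 1 - u^2 - (1-u)^2 = 2u(1-u). *)
have -> : e = d ^+ 2 * ((a / 4) ^+ 2 * (1 - a) / 2 * (1 - (a / 4) ^+ 2 - (1 - a / 4) ^+ 2)
  + (a / 4) ^+ 2 * (3 / 4 * a * d) + 2 * (a / 4) * (1 - a / 4) * (a * d / 4)
  + (1 - a / 4) ^+ 2 * (d * (1 - a / 4))) by rewrite /e; field.
have [a0' a1'] := (a0, a1).
have b0 : 0 <= 1 - a / 4 by lra.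
have -> : 1 - (a / 4) ^+ 2 - (1 - a / 4) ^+ 2 = 2 * (a / 4) * (1 - a / 4) by ring.
have c1 : 0 <= 1 - a by lra.
have [a' d'] := (ltW a0, ltW d0); have a4 : 0 <= a / 4 by rewrite divr_ge0.
move: (1 - a / 4) (1 - a) b0 c1 => b1 c1 b0 c0'.
by rewrite !(addr_ge0, mulr_ge0, sqr_ge0, invr_ge0).
Qed.

(** The row e2 Y has size of order t; the polynomial bounds with threshold [t] give order t^s for s
    <= 2, and order t^2 beyond. *)
Lemma half_upper s t y : 0 < y -> y <= t -> t <= 1 -> 0 < s ->
  bform (mpow (wmean a (twoval P0 1 t) (twoval Q0 t y)) s) (rv2 0 1) (rv2 0 1)
    <= if s <= 2 then 3 * powR t s else 2 * t ^+ 2.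
Proof.
move=> y0 yt t1 s0; set Y := wmean _ _ _.
have t0 : 0 < t by exact: lt_le_trans yt.
have Y0 : psdmx Y.
  by apply: psdmx_wmean; rewrite ?(ltW a0) ?(ltW a1)//; apply: pdmx_psdmx;
    apply: pdmx_twoval.
have Y1 : qle Y 1%:M.
  by apply: (@wmean_scalar_le _ _ _ 1) => //; apply: twoval_le => //; lra.
(* The entries of e2 Y are a(t-y)/2 and (1-a)t + a(t+y)/2, both in [0, t]. *)
have vY : bform 1%:M (rv2 0 1 *m Y) (rv2 0 1 *m Y) <= 2 * t ^+ 2.
  rewrite /Y !twoval_sym2 wmean_sym2 rv2_mul_sym2 bform1_rv2.
  set f := _ + 1 * _; set g := (0 * _ + 1 * _).
  have sq x : 0 <= x -> x <= t -> x * x <= t ^+ 2.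
    by move=> x0 xt; rewrite expr2 ler_pM.
  have fE : f = a * (t - y) / 2 by rewrite /f; field.
  have gE : g = (1 - a) * t + a * ((t + y) / 2) by rewrite /g; field.
  have [a0' a1'] := (a0, a1).
  have f0 : 0 <= f by rewrite fE divr_ge0 ?mulr_ge0 ?subr_ge0// ltW.
  have g0 : 0 <= g.
    have [a' [t' y']] := (ltW a0, (ltW t0, ltW y0)).
    have c1 : 0 <= 1 - a by lra.
    rewrite gE addr_ge0//; first by rewrite mulr_ge0.
    by rewrite mulr_ge0// divr_ge0// addr_ge0.
  have h1 : 0 <= a * (t - y) by rewrite mulr_ge0 ?subr_ge0// ltW.
  have h2 : a * (t - y) <= 1 * (t - y) by rewrite ler_wpM2r ?subr_ge0// ltW.
  have ft : f <= t by rewrite fE; lra.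
  have gt : g <= t by rewrite gE; lra.
  have := sq _ f0 ft; have := sq _ g0 gt; move: (f * f) (g * g) (t ^+ 2) => ? ? ?.
  by lra.
case: ifPn => [s2|]; last first.
  rewrite -ltNge => /ltW s2; apply: le_trans vY.
  exact: mpow_upper_sq.
have s02 : 0 <= s <= 2 by rewrite ltW.
apply: le_trans (mpow_upper_small (rv2 0 1) Y0 t0 s02) _.
rewrite (bform1_rv2 0 1 0 1) mul0r add0r !mulr1.
have -> : 3 * powR t s = powR t s + powR t (s - 2) * (2 * t ^+ 2).
  rewrite -(powR_mulrn _ (ltW t0)) mulrCA -powRD_gt0// subrK.
  by move: (powR t s) => z; ring.
by rewrite lerD2l ler_wpM2l ?powR_ge0.
Qed.

Lemma le2_half p q : 0 < p -> p < q -> le2 p q -> 2^-1 <= p.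
Proof.
move=> p0 pq h; rewrite leNgt; apply/negP => p2.
have q0 : 0 < q by exact: lt_trans pq.
have s2 : 2 < p^-1 by rewrite -[ltLHS]invrK ltf_pV2 ?posrE ?invr_gt0.
have [c cE] : exists c, c = (a / 4) ^+ 2 * (1 - a) / 2 by eexists.
have c0 : 0 < c by rewrite cE !(divr_gt0, mulr_gt0, exprn_gt0, subr_gt0).
(* [u] is the exponent of d in the bound of [half_upper] for t = d^(q/p); it exceeds 2 since p < 1/2
   and p < q. *)
set u := if q^-1 <= 2 then p^-1 else 2 * (q / p).
have u2 : 0 < u - 2.
  rewrite subr_gt0 /u; case: ifP => // _.
  by rewrite ltr_pMr// ltr_pdivlMr// mul1r.
(* The divisor 6 is twice the constant 3 of the upper bound, so the upper bound is at most half of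
   the lower one. *)
have K0 : 0 < powR c (p^-1 - 2) * c / 6 by rewrite divr_gt0// mulr_gt0// powR_gt0.
have [d [d0 d1 dK]] := powR_small u2 K0.
have d2 : 0 < d / 2 by rewrite divr_gt0.
(* The p-th roots make the p-th powers those of [half_lower]; the q-th powers then have the
   eigenvalues of [half_upper] with t = d^(q/p) and y = (d/2)^(q/p). *)
set A := twoval P0 1 (powR d p^-1).
set B := twoval Q0 (powR d p^-1) (powR (d / 2) p^-1).
have A0 : pdmx A by apply: pdmx_twoval; rewrite ?powR_gt0.
have B0 : pdmx B by apply: pdmx_twoval; rewrite ?powR_gt0.
have pp : p^-1 * p = 1 by rewrite mulVf ?gt_eqF.
have qp : p^-1 * q = q / p by rewrite mulrC.
have [t tE] : exists t, t = powR d (q / p) by eexists.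
have [y yE] : exists y, y = powR (d / 2) (q / p) by eexists.
have E1 x : 0 <= x -> powR (powR x p^-1) p = x.
  by move=> x0; rewrite -powRrM pp powRr1.
have E2 x : powR (powR x p^-1) q = powR x (q / p) by rewrite -powRrM qp.
have EAp : mpow A p = twoval P0 1 d.
  apply: etrans (mpow_twoval hP0 P0P0 _ _ _) _.
  by congr twoval; [exact: powR1l|exact/E1/ltW].
have EBp : mpow B p = twoval Q0 d (d / 2).
  apply: etrans (mpow_twoval hQ0 Q0Q0 _ _ _) _.
  by congr twoval; apply: E1; exact: ltW.
have EAq : mpow A q = twoval P0 1 t.
  apply: etrans (mpow_twoval hP0 P0P0 _ _ _) _; rewrite tE.
  by congr twoval; [exact: powR1l|exact: E2].
have EBq : mpow B q = twoval Q0 t y.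
  apply: etrans (mpow_twoval hQ0 Q0Q0 _ _ _) _; rewrite tE yE.
  by congr twoval; exact: E2.
clearbody A B.
have := le2_qle h A0 B0 (rv2 0 1).
rewrite EAp EBp EAq EBq => le1.
have q1 : 0 < q / p by rewrite divr_gt0.
have le3 := le_trans (half_lower cE d0 d1 (ltW s2)) le1.
have y0 : 0 < y by rewrite yE powR_gt0.
have yt : y <= t.
  have dd : d / 2 <= d by rewrite ler_pdivrMr// ler_peMr ?ler1n// ltW.
  by rewrite yE tE; apply: (ge0_ler_powR (ltW q1)); rewrite ?nnegrE ?(ltW d0) ?(ltW d2).
have t1 : t <= 1.
  rewrite tE -[leRHS](powR1l (q / p)).
  by apply: (ge0_ler_powR (ltW q1)); rewrite ?nnegrE ?(ltW d0).
have qi : 0 < q^-1 by rewrite invr_gt0.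
have := le_trans le3 (half_upper y0 yt t1 qi).
have -> : (if q^-1 <= 2 then 3 * powR t q^-1 else 2 * t ^+ 2) =
    (if q^-1 <= 2 then 3 else 2) * powR d u.
  rewrite /u tE; case: ifP => _; rewrite -?powRrM.
    by congr (_ * powR _ _); field; rewrite !gt_eqF.
  rewrite -powR_mulrn ?powR_ge0// -powRrM.
  by congr (_ * powR _ _); ring.
have -> : powR d u = powR d (u - 2) * d ^+ 2.
  by rewrite -powR_mulrn ?(ltW d0)// -powRD_gt0// subrK.
rewrite mulrA [leRHS]mulrA ler_pM2r ?exprn_gt0//.
have : (if q^-1 <= 2 then 3 else 2) <= 3 :> R by case: ifP => _; lra.
have := powR_ge0 d (u - 2); move: dK K0.
move: (powR d (u - 2)) (_ * c) (if _ then _ else _) => x k z xk k0 x0 z3.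
have zx : z * x <= 3 * x by rewrite ler_wpM2r.
by move=> kzx; lra.
Qed.

(** * Necessity of 1 <= q, by tilted eigenvectors *)

Let sq1_neq0 t : 1 + t * t != 0.
Proof. by rewrite gt_eqF// ltr_pwDl// -expr2 sqr_ge0. Qed.

(** The orthogonal projection onto the line of (1, t). *)
Let Qt t : 'M[R[i]]_2 :=
  let i := (1 + t * t)^-1 in sym2 i (t * i) (t * t * i).
Let hQt t : hermitian (Qt t). Proof. exact: hermitian_sym2. Qed.
Let QtQt t : Qt t *m Qt t = Qt t.
Proof. by apply: sym2_idem; field; exact: sq1_neq0. Qed.

(** The first entry isolates (1-a) w - a h (1-w) i, which is of order t^2 for [h = g] and bounded
    away from 0 for h < g, once (1-a) w = a g (1-w). *)
Let tilt_mul h y w t : let i := (1 + t * t)^-1 in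
  rv2 (- (w * t)) 1 *m wmean a (twoval P0 1 y) (twoval (Qt t) h y) =
  rv2 (- t * ((1 - a) * w - a * h * (1 - w) * i + a * y * ((w * (t * t) + 1) * i)))
      ((1 - a) * y + a * h * (1 - w) * (t * t * i) + a * y * ((w * (t * t) + 1) * i)).
Proof.
rewrite /= !twoval_sym2 wmean_sym2 rv2_mul_sym2.
by congr rv2; field; exact: sq1_neq0.
Qed.

Let inv_bounds t : let i := (1 + t * t)^-1 in [/\ 0 < i, i <= 1 & t * t * i = 1 - i].
Proof.
have D0 : 0 < 1 + t * t by rewrite ltr_pwDl// -expr2 sqr_ge0.
split; first by rewrite invr_gt0.
  by rewrite invf_le1// lerDl -expr2 sqr_ge0.
by field; exact: sq1_neq0.
Qed.

Let psdmx_tilt h y t : 0 < h -> 0 < y ->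
  psdmx (wmean a (twoval P0 1 y) (twoval (Qt t) h y)).
Proof.
move=> h0 y0; have [a0' a1'] := (ltW a0, ltW a1).
exact: (psdmx_wmean a0' a1' (pdmx_psdmx (pdmx_twoval hP0 P0P0 ltr01 y0))
  (pdmx_psdmx (pdmx_twoval (hQt t) (QtQt t) h0 y0))).
Qed.

(* The relation on [w] makes [rv2 (- (w * t)) 1] orthogonal, to first order in
   [t], to the top eigenvector of the mean with eigenvalue [g] in place of [h],
   but not to that of the mean with [h < g]. *)
Lemma tilt_lower s h g y w t : 0 < h -> h < g -> h <= 2 -> 0 < y -> y <= 1 ->
    0 <= w -> w < 1 -> (1 - a) * w = a * g * (1 - w) -> 0 < s -> s <= 2 ->
  powR 2 (s - 2) * (t * t * (a * (1 - w) * (g - h)) ^+ 2) <=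
  bform (mpow (wmean a (twoval P0 1 y) (twoval (Qt t) h y)) s)
    (rv2 (- (w * t)) 1) (rv2 (- (w * t)) 1).
Proof.
move=> h0 hg h2 y0 y1 w0 w1 wE s0 s2.
have X0 := psdmx_tilt t h0 y0.
have X2 : qle (wmean a (twoval P0 1 y) (twoval (Qt t) h y)) 2%:C%:M.
  by apply: wmean_scalar_le => //; apply: twoval_le => //; lra.
have two0 : 0 < 2 :> R by rewrite ltr0n.
apply: le_trans (mpow_lower_small _ X0 two0 s2 s0 X2).
rewrite ler_wpM2l ?powR_ge0// tilt_mul bform1_rv2 wE.
have [i0 i1 _] := inv_bounds t; move: (_^-1) i0 i1 => i i0 i1.
set f := - t * _; set k := (_ + _ + _).
have tt0 : 0 <= t * t by rewrite -expr2 sqr_ge0.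
(* The first entry is - t z, with z >= c because i <= 1; the square of the second entry is
   dropped. *)
have [z zE] : exists z, z = a * (1 - w) * (g - h * i) + a * y * ((w * (t * t) + 1) * i).
  by eexists.
have [c cE] : exists c, c = a * (1 - w) * (g - h) by eexists.
have -> : f = - t * z by rewrite /f zE; congr (_ * _); ring.
rewrite -cE.
have a0' := ltW a0.
have w1' : 0 <= 1 - w by rewrite subr_ge0 ltW.
have c0 : 0 <= c by rewrite cE !mulr_ge0// subr_ge0 ltW.
have cz : c <= z.
  rewrite cE zE -[leLHS]addr0 lerD//.
    by rewrite ler_wpM2l ?mulr_ge0// lerD2l lerN2 ler_piMr// ltW.
  have [y0' i0'] := (ltW y0, ltW i0).
  by rewrite mulr_ge0 ?(mulr_ge0 a0')// mulr_ge0// addr_ge0// mulr_ge0.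
have -> : - t * z * (- t * z) = t * t * (z * z) by ring.
rewrite -[leLHS]addr0 lerD -?expr2 ?sqr_ge0//.
by rewrite ler_wpM2l ?sqr_ge0// ler_sqr ?nnegrE// (le_trans c0).
Qed.

(** With T = t^2, the image of the test vector has entries of size at most 3T and 4T, and T is the
    threshold in [mpow_upper_small]. The constant 27 is 2, for the squared norm of the vector, plus
    25 = 3^2 + 4^2. *)
Lemma tilt_upper s g w t : 0 < g -> g <= 2 -> 0 < t -> t <= 1 ->
    0 <= w -> w <= 1 -> (1 - a) * w = a * g * (1 - w) -> 0 <= s -> s <= 2 ->
  bform (mpow (wmean a (twoval P0 1 (t * t)) (twoval (Qt t) g (t * t))) s)
    (rv2 (- (w * t)) 1) (rv2 (- (w * t)) 1) <= 27 * powR (t * t) s.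
Proof.
move=> g0 g2 t0 t1 w0 w1 wE s0 s2.
have T0 : 0 < t * t by rewrite mulr_gt0.
have T1 : t * t <= 1 by rewrite mulr_ile1 ?(ltW t0).
have Y0 := psdmx_tilt t g0 T0.
have s02 : 0 <= s <= 2 by rewrite s0.
apply: le_trans (mpow_upper_small _ Y0 T0 s02) _.
rewrite tilt_mul !bform1_rv2 wE.
have [i0 i1 iE] := inv_bounds t; move: (_^-1) i0 i1 iE => i i0 i1 iE.
rewrite iE; set f := - t * _; set k := (_ + _ + _).
move: (t * t) T0 T1 iE @f @k => T T0 T1 iE f k.
have [a0' a1'] := (ltW a0, ltW a1); have T0' := ltW T0.
have [e eE] : exists e, e = a * g * (1 - w) by eexists.
have [m mE] : exists m, m = (w * T + 1) * i by eexists.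
have w1' : 0 <= 1 - w by rewrite subr_ge0.
have e0 : 0 <= e by rewrite eE !mulr_ge0// ltW.
have e2 : e <= 2.
  rewrite eE -[leRHS]mulr1 ler_pM//; [by rewrite mulr_ge0// ltW| |by rewrite gerBl].
  by rewrite -[leRHS]mul1r ler_pM// ltW.
have m0 : 0 <= m by rewrite mE mulr_ge0 ?(ltW i0)// addr_ge0// mulr_ge0.
have m1 : m <= 1.
  have -> : m = w * (1 - i) + i by rewrite mE -iE; ring.
  have : w * (1 - i) <= 1 * (1 - i) by rewrite ler_wpM2r// subr_ge0.
  by lra.
have iT : 1 - i <= T by rewrite -iE ler_piMr.
have i1' : 0 <= 1 - i by rewrite subr_ge0.
have ei0 : 0 <= e * (1 - i) by rewrite mulr_ge0.
have eiT : e * (1 - i) <= 2 * T by rewrite ler_pM.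
have am0 : 0 <= a * T * m by rewrite !mulr_ge0.
have amT : a * T * m <= T.
  by rewrite -[leRHS]mulr1 ler_pM ?mulr_ge0// ler_piMl.
have aT : (1 - a) * T <= T by rewrite ler_piMl// gerBl.
have aT0 : 0 <= (1 - a) * T by rewrite mulr_ge0// subr_ge0.
have [z zE] : exists z, z = e * (1 - i) + a * T * m by eexists.
have fE : f = - t * z by rewrite /f zE eE mE; congr (_ * _); ring.
have kE : k = (1 - a) * T + e * (1 - i) + a * T * m by rewrite /k eE mE.
have z0 : 0 <= z by rewrite zE addr_ge0.
have z3 : z <= 3 * T by rewrite zE; lra.
have k0 : 0 <= k by rewrite kE !addr_ge0.
have k4 : k <= 4 * T by rewrite kE; lra.
have ff : f * f <= 3 * T * (3 * T).
  have -> : f * f = (t * z) * (t * z) by rewrite fE; ring.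
  have tz0 : 0 <= t * z by rewrite mulr_ge0// ltW.
  have tz3 : t * z <= 3 * T by rewrite (le_trans _ z3)// ler_piMl.
  by rewrite ler_pM.
have kk : k * k <= 4 * T * (4 * T) by rewrite ler_pM.
have fk : f * f + k * k <= 25 * T ^+ 2.
  have -> : 25 * T ^+ 2 = 3 * T * (3 * T) + 4 * T * (4 * T) by ring.
  exact: lerD.
have vv : - (w * t) * - (w * t) + 1 * 1 <= 2.
  have -> : - (w * t) * - (w * t) + 1 * 1 = (w * t) * (w * t) + 1 by ring.
  have wt0 : 0 <= w * t by rewrite mulr_ge0// ltW.
  have wt1 : w * t <= 1 by rewrite mulr_ile1// ltW.
  have : (w * t) * (w * t) <= 1 by rewrite mulr_ile1.
  by lra.
have -> : 27 * powR T s = powR T s * 2 + powR T (s - 2) * (25 * T ^+ 2).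
  rewrite -(powR_mulrn _ T0') mulrCA -powRD_gt0// subrK.
  by move: (powR T s) => x; ring.
by rewrite lerD// ler_wpM2l ?powR_ge0.
Qed.

Lemma le2_one p q : 2^-1 <= p -> p < q -> le2 p q -> 1 <= q.
Proof.
move=> p2 pq h; rewrite leNgt; apply/negP => q1.
have p0 : 0 < p by rewrite (lt_le_trans _ p2)// invr_gt0.
have q0 : 0 < q by exact: lt_trans pq.
have s0 : 0 < p^-1 by rewrite invr_gt0.
have s2 : p^-1 <= 2 by rewrite invf_ple ?posrE.
have r1 : 0 < q^-1 - 1 by rewrite subr_gt0 invf_gt1.
have r2 : q^-1 <= 2.
  by rewrite invf_ple ?posrE// (le_trans p2)// ltW.
(* [g] and [k] are the top eigenvalues of B^q and B^p for B with top eigenvalue 2; k < g makes the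
   tilts differ. *)
have [g gE] : exists g, g = powR 2 q by eexists.
have [k kE] : exists k, k = powR 2 p by eexists.
have k0 : 0 < k by rewrite kE powR_gt0.
have g0 : 0 < g by rewrite gE powR_gt0.
have le2x s : s <= 1 -> powR 2 s <= 2 :> R.
  by move=> s1; rewrite -[leRHS]powRr1// ler_powR// ler1n.
have k2 : k <= 2 by rewrite kE le2x// ltW// (lt_trans pq).
have g2 : g <= 2 by rewrite gE le2x// ltW.
have kg : k < g.
  have -> : g = k * powR 2 (q - p).
    by rewrite gE kE -powRD_gt0//; congr powR; ring.
  rewrite ltr_pMr// -[ltLHS](powR1l (q - p)).
  by apply: gt0_ltr_powR; rewrite ?nnegrE ?subr_gt0 ?ltr1n.
have ag0 : 0 < a * g by rewrite mulr_gt0.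
have D0 : 0 < 1 - a + a * g by rewrite addr_gt0// subr_gt0.
(* The solution of (1-a) w = a g (1-w), which adapts the test vector to the q-sum. *)
have [w wE] : exists w, w = a * g / (1 - a + a * g) by eexists.
have w0 : 0 <= w by rewrite wE divr_ge0// ltW.
have w1 : w < 1 by rewrite wE ltr_pdivrMr// mul1r ltrDr subr_gt0.
have wE' : (1 - a) * w = a * g * (1 - w) by rewrite wE; field; rewrite gt_eqF.
have [c cE] : exists c, c = (a * (1 - w) * (g - k)) ^+ 2 by eexists.
have c0 : 0 < c by rewrite cE exprn_gt0// !mulr_gt0// subr_gt0.
have [K KE] : exists K, K = powR 2 (p^-1 - 2) * c by eexists.
have K0 : 0 < K by rewrite KE mulr_gt0// powR_gt0.
(* 54 is twice the constant 27 of [tilt_upper], so K T <= 27 T^(1/q) would give K <= K/2. *)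
have K1 : 0 < K / 54 by rewrite divr_gt0.
have [T [T0 T1 TK]] := powR_small r1 K1.
have [t tE] : exists t, t = Num.sqrt T by eexists.
have t0 : 0 < t by rewrite tE sqrtr_gt0.
have t1 : t <= 1 by rewrite tE -sqrtr1 ler_sqrt.
have tt : t * t = T by rewrite tE -expr2 sqr_sqrtr// ltW.
(* The common small eigenvalue x of both matrices satisfies x^q = T = t^2. *)
have [x xE] : exists x, x = powR T q^-1 by eexists.
have x0 : 0 < x by rewrite xE powR_gt0.
have x1 : x <= 1.
  rewrite xE -[leRHS](powR1l q^-1).
  by apply: ge0_ler_powR; rewrite ?nnegrE ?invr_ge0 ?(ltW q0) ?(ltW T0).
have [y yE] : exists y, y = powR x p by eexists.
have y0 : 0 < y by rewrite yE powR_gt0.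
have y1 : y <= 1.
  rewrite yE -[leRHS](powR1l p).
  by apply: ge0_ler_powR; rewrite ?nnegrE ?(ltW p0) ?(ltW x0).
have xq : powR x q = t * t.
  by rewrite tt xE -powRrM mulVf ?gt_eqF// powRr1// ltW.
set A := twoval P0 1 x; set B := twoval (Qt t) 2 x.
have A0 : pdmx A by exact: pdmx_twoval.
have B0 : pdmx B by exact: pdmx_twoval.
have EAp : mpow A p = twoval P0 1 y.
  apply: etrans (mpow_twoval hP0 P0P0 _ _ _) _.
  by congr twoval; [exact: powR1l|exact: esym].
have EBp : mpow B p = twoval (Qt t) k y.
  apply: etrans (mpow_twoval (hQt t) (QtQt t) _ _ _) _.
  by congr twoval; exact: esym.
have EAq : mpow A q = twoval P0 1 (t * t).
  apply: etrans (mpow_twoval hP0 P0P0 _ _ _) _.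
  by congr twoval; [exact: powR1l|exact: xq].
have EBq : mpow B q = twoval (Qt t) g (t * t).
  apply: etrans (mpow_twoval (hQt t) (QtQt t) _ _ _) _.
  by congr twoval; [exact: esym|exact: xq].
clearbody A B.
have := le2_qle h A0 B0 (rv2 (- (w * t)) 1).
rewrite EAp EBp EAq EBq => le1.
have r0 : 0 <= q^-1 by rewrite invr_ge0 ltW.
have := le_trans (le_trans (tilt_lower t k0 kg k2 y0 y1 w0 w1 wE' s0 s2) le1)
  (tilt_upper g0 g2 t0 t1 w0 (ltW w1) wE' r0 r2).
have -> : powR (t * t) q^-1 = powR T (q^-1 - 1) * T.
  by rewrite tt -[X in _ * X](powRr1 (ltW T0)) -powRD_gt0// subrK.
rewrite tt -cE mulrCA -KE.
have -> : 27 * (powR T (q^-1 - 1) * T) = T * (27 * powR T (q^-1 - 1)) by ring.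
rewrite ler_pM2l//; move: (powR T _) TK => z zK Kz.
by lra.
Qed.

End Necessity.

Theorem theorem4p1 (R : realType) (alpha p q : R) :
  0 < alpha -> alpha < 1 -> 0 < p -> 0 < q ->
  let cond_i := forall (n : nat) (A B : 'M[R[i]]_n),
      psdmx A -> psdmx B -> loewner_le (powmean alpha p A B) (powmean alpha q A B) in
  let cond_ii := forall A B : 'M[R[i]]_2,
      pdmx A -> pdmx B -> loewner_le (powmean alpha p A B) (powmean alpha q A B) in
  let cond_iii := p = q \/ (1 <= p /\ p < q) \/ (2^-1 <= p /\ p < 1 /\ 1 <= q) in
  (cond_i <-> cond_ii) /\ (cond_ii <-> cond_iii).
Proof.
move=> a0 a1 p0 q0 ci cii ciii.
have iii_i : ciii -> ci.
  by move=> h n A B A0 B0; exact: (powmean_le_sufficient (ltW a0) (ltW a1) A0 B0 h).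
have i_ii : ci -> cii by move=> h A B A0 B0; apply: h; exact: pdmx_psdmx.
(* The cycle (iii), (i), (ii), (iii) of implications yields both equivalences. *)
suff ii_iii : cii -> ciii.
  by split; split=> // h; [apply/iii_i/ii_iii|apply/i_ii/iii_i].
move=> h; have := le2_order a0 a1 p0 q0 h; rewrite le_eqVlt => /orP[/eqP|] pq.
  by left.
right; have [p1|p1] := leP 1 p; first by left.
right; have p2 := le2_half a0 a1 p0 pq h.
by split=> //; split=> //; exact: (le2_one a0 a1 p2 pq h).
Qed.
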